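(* Let $\mathcal A$ be a $C^*$-algebra, $\alpha_1,\dots,\alpha_k$ commuting $*$-automorphisms of $\mathcal A$, and $\mathbb E$ the associated automorphic product system over $\mathbb Z_+^k$ with fibers $E_i={}_{\alpha_i}\mathcal A$ and flips $t_{ij}(a\otimes b)=\alpha_i^{-1}\alpha_j(a)\otimes b$. Let $\sigma:\mathcal A\to\mathcal B(\mathcal H)$ be a nondegenerate $*$-representation, $T_i:E_i\to\mathcal B(\mathcal H)$ linear maps ($i\in I_k$), and $\{U_{ij}\}_{i\neq j}\subseteq\mathcal B(\mathcal H)$ pairwise commuting unitaries with $U_{ji}=U_{ij}^*$, $U_{ij}\sigma(a)=\sigma(a)U_{ij}$ and $U_{ij}T_\ell(a)=T_\ell(a)U_{ij}$ for all $a\in\mathcal A$, $\ell\in I_k$, $i\ne j$. Then $(\sigma,T_1,\dots,T_k)$ is a doubly twisted representation of $\mathbb E$ with respect to the twists $\{t_{ij}\otimes U_{ij}\}_{i\ne j}$ if and only if there exist contractions $S_1,\dots,S_k\in\mathcal B(\mathcal H)$ such that $T_i(a)=S_i\sigma(a)$ for all $a\in\mathcal A$, $i\in I_k$, and for all $a\in\mathcal A$ and $i\neq j$, $$\sigma(a)S_i=S_i\sigma(\alpha_i(a)),\qquad S_iS_j=U_{ij}S_jS_i,\qquad S_i^*S_j=U_{ij}^*S_jS_i^*.$$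
   Context: Hilbert spaces are complex and separable; $I_k=\{1,\dots,k\}$. The correspondence ${}_{\alpha}\mathcal A$ is $\mathcal A$ as a vector space, with right action by multiplication, left action $\varphi(a)c=\alpha(a)c$, and inner product $\langle c_1,c_2\rangle=c_1^*c_2$. The balanced tensor product $E_i\otimes_{\mathcal A}E_j$ is identified with ${}_{\alpha_j\circ\alpha_i}\mathcal A$ via $a\otimes b\mapsto\alpha_j(a)b$. For a correspondence $E$ and representation $\sigma$ on $\mathcal H$, $E\otimes_\sigma\mathcal H$ is the completion with $\langle\xi\otimes h,\eta\otimes k\rangle=\langle h,\sigma(\langle\xi,\eta\rangle)k\rangle$. $(\sigma,T_1,\dots,T_k)$ is a doubly twisted representation of $\mathbb E$ with twists $\{t_{ij}\otimes U_{ij}\}_{i\ne j}$ if: each $T_i:E_i\to\mathcal B(\mathcal H)$ is linear, completely contractive and satisfies $T_i(a\cdot\xi\cdot b)=\sigma(a)T_i(\xi)\sigma(b)$ (where $a\cdot\xi=\varphi_i(a)\xi$); with $\widetilde T_i:E_i\otimes_\sigma\mathcal H\to\mathcal H$, $\widetilde T_i(\xi\otimes h)=T_i(\xi)h$, the unitaries $U_{ij}$ satisfy $U_{ji}=U_{ij}^*$, $U_{ij}\widetilde T_\ell=\widetilde T_\ell(I_{E_\ell}\otimes U_{ij})$, $U_{ij}\sigma(a)=\sigma(a)U_{ij}$; and for all $i\ne j$, $\widetilde T_i(I_{E_i}\otimes\widetilde T_j)=\widetilde T_j(I_{E_j}\otimes\widetilde T_i)(t_{ij}\otimes U_{ij})$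 and $\widetilde T_j^*\widetilde T_i=(I_{E_j}\otimes\widetilde T_i)(t_{ij}\otimes U_{ij})(I_{E_i}\otimes\widetilde T_j^* )$. *)

(* Defs.v *)
From HB Require Import structures.
From mathcomp Require Import all_boot all_order all_algebra.
From mathcomp Require Import complex.
From mathcomp Require Import boolp classical_sets functions cardinality reals.
From mathcomp Require Import topology normedtype.

Set Implicit Arguments.
Unset Strict Implicit.
Unset Printing Implicit Defensive.

Import Order.TTheory GRing.Theory Num.Theory.
Import numFieldNormedType.Exports.

Local Open Scope classical_set_scope.
Local Open Scope complex_scope.
Local Open Scope ring_scope.

(* Norms take their values in R[i], where [x <= y] forces [y - x] to be real. *)

(* The inner product is linear in the second variable. *)
HB.mixin Record CompleteNormedModule_isHilbert (R : realType) H
    & CompleteNormedModule R[i] H := {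
  hdot : H -> H -> R[i];
  hdotP : forall x, linear_for *%R (hdot x);
  hdotC : forall x y, hdot y x = Num.conj (hdot x y);
  hdot_norm : forall x, hdot x x = `|x| ^+ 2
}.

#[short(type="hilbertType")]
HB.structure Definition Hilbert (R : realType) :=
  {H of CompleteNormedModule R[i] H & CompleteNormedModule_isHilbert R H}.

(* C*-algebras need not have a unit, hence no ring structure. *)
HB.mixin Record CompleteNormedModule_isCStar (R : realType) A
    & CompleteNormedModule R[i] A := {
  amul : A -> A -> A;
  star : A -> A;
  amulA : associative amul;
  amul_linl : forall b, linear (amul^~ b);
  amul_linr : forall a, linear (amul a);
  starK : involutive star;
  starP : forall (c : R[i]) a b,
    star (c *: a + b) = Num.conj c *: star a + star b;
  starM : forall a b, star (amul a b) = amul (star b) (star a);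
  amul_norm : forall a b, `|amul a b| <= `|a| * `|b|;
  star_norm : forall a, `|amul (star a) a| = `|a| ^+ 2
}.

#[short(type="cstarAlgType")]
HB.structure Definition CStar (R : realType) :=
  {A of CompleteNormedModule R[i] A & CompleteNormedModule_isCStar R A}.

Record bop (R : realType) (V W : normedModType R[i]) := Bop {
  bop_fun :> V -> W;
  bop_linear : linear bop_fun;
  bop_continuous : continuous bop_fun
}.

HB.instance Definition _ (R : realType) (V W : normedModType R[i])
    (f : bop V W) :=
  GRing.isLinear.Build R[i] V W *:%R (bop_fun f) (bop_linear f).

Section BoundedOperators.
Variable R : realType.
Local Notation C := R[i].

Section BopPointed.
Variables V W : normedModType C.

Lemma bop0_linear : linear (fun _ : V => 0 : W).
Proof. by move=> c x y; rewrite scaler0 addr0. Qed.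

Lemma bop0_continuous : continuous (fun _ : V => 0 : W).
Proof. by move=> x; apply: cvg_cst. Qed.

HB.instance Definition _ := gen_eqMixin (bop V W).
HB.instance Definition _ := gen_choiceMixin (bop V W).
HB.instance Definition _ :=
  isPointed.Build (bop V W) (Bop bop0_linear bop0_continuous).
End BopPointed.

Definition contractive (V W : normedModType C) (f : bop V W) :=
  forall x, `|f x| <= `|x|.

(* The adjoint, selected by its defining property. *)
Definition adj (H K : hilbertType R) (f : bop H K) : bop K H :=
  get [set g : bop K H | forall x y, hdot (g y) x = hdot y (f x)].

Definition unitary (H : hilbertType R) (u : bop H H) :=
  adj u \o u =1 id /\ u \o adj u =1 id.

Definition separable (T : topologicalType) :=
  exists2 D : set T, countable D & dense D.

Definition lspan (V : lmodType C) (D : set V) : set V :=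
  [set v | exists n (c : 'I_n -> C) (d : 'I_n -> V),
     (forall i, D (d i)) /\ v = \sum_(i < n) c i *: d i].

(* Linearity of a map into the space of bounded operators. *)
Definition op_linear (E V W : normedModType C) (T : E -> bop V W) :=
  forall (c : C) x y v, T (c *: x + y) v = c *: T x v + T y v.

End BoundedOperators.

Section Algebras.
Variables (R : realType) (A : cstarAlgType R).
Local Notation C := R[i].

Record star_aut := StarAut {
  aut_fun :> A -> A;
  aut_inv : A -> A;
  aut_funK : cancel aut_fun aut_inv;
  aut_invK : cancel aut_inv aut_fun;
  aut_linear : linear aut_fun;
  autM : forall a b, aut_fun (amul a b) = amul (aut_fun a) (aut_fun b);
  aut_star : forall a, aut_fun (star a) = star (aut_fun a)
}.

Program Definition aut_comp (f g : star_aut) : star_aut :=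
  @StarAut (f \o g) (aut_inv g \o aut_inv f) _ _ _ _ _.
Next Obligation. by move=> f g x /=; rewrite !aut_funK. Qed.
Next Obligation. by move=> f g x /=; rewrite !aut_invK. Qed.
Next Obligation. by move=> f g c x y /=; rewrite !aut_linear. Qed.
Next Obligation. by move=> f g a b /=; rewrite !autM. Qed.
Next Obligation. by move=> f g a /=; rewrite !aut_star. Qed.

Definition star_rep (H : hilbertType R) (sigma : A -> bop H H) :=
  [/\ op_linear sigma,
      forall a b, sigma (amul a b) =1 sigma a \o sigma b &
      forall a x y, hdot (sigma a x) y = hdot x (sigma (star a) y)].

Definition nondegenerate_rep (H : hilbertType R) (sigma : A -> bop H H) :=
  dense (lspan [set v | exists a h, v = sigma a h]).

(* A C*-correspondence over A: a right Hilbert A-module with a left action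
   of A by adjointable operators. The positive elements of A are those of the
   form b^* b. *)
Record corr := Corr {
  corr_car :> completeNormedModType C;
  cdot : corr_car -> corr_car -> A;
  ract : corr_car -> A -> corr_car;
  lact : A -> corr_car -> corr_car;
  cdot_linear : forall x, linear (cdot x);
  cdot_star : forall x y, cdot y x = star (cdot x y);
  cdot_ge0 : forall x, exists b, cdot x x = amul (star b) b;
  cdot_norm : forall x, `|cdot x x| = `|x| ^+ 2;
  cdot_ract : forall x y a, cdot x (ract y a) = amul (cdot x y) a;
  ract_linl : forall a, linear (ract^~ a);
  ract_linr : forall x, linear (ract x);
  ractM : forall x a b, ract x (amul a b) = ract (ract x a) b;
  lact_linl : forall x, linear (lact^~ x);
  lact_linr : forall a, linear (lact a);
  lactM : forall a b x, lact (amul a b) x = lact a (lact b x);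
  lact_ract : forall a x b, lact a (ract x b) = ract (lact a x) b;
  lact_adj : forall a x y, cdot (lact a x) y = cdot x (lact (star a) y)
}.

Program Definition autcorr (alpha : star_aut) : corr :=
  @Corr A (fun c1 c2 => amul (star c1) c2) (fun c b => amul c b)
    (fun a c => amul (alpha a) c) _ _ _ _ _ _ _ _ _ _ _ _ _.
Next Obligation. by move=> alpha x c y z; rewrite /= amul_linr. Qed.
Next Obligation. by move=> alpha x y; rewrite /= starM starK. Qed.
Next Obligation. by move=> alpha x; exists x. Qed.
Next Obligation. by move=> alpha x; rewrite /= star_norm. Qed.
Next Obligation. by move=> alpha x y a; rewrite /= amulA. Qed.
Next Obligation. by move=> alpha a; apply: amul_linl. Qed.
Next Obligation. by move=> alpha x; apply: amul_linr. Qed.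
Next Obligation. by move=> alpha x a b; rewrite /= amulA. Qed.
Next Obligation.
by move=> alpha x c a b /=; rewrite aut_linear amul_linl.
Qed.
Next Obligation. by move=> alpha a; apply: amul_linr. Qed.
Next Obligation. by move=> alpha a b x /=; rewrite autM amulA. Qed.
Next Obligation. by move=> alpha a x b; rewrite /= amulA. Qed.
Next Obligation.
by move=> alpha a x y; rewrite /= starM -aut_star -amulA.
Qed.

Section Representations.
Variables (H : hilbertType R) (sigma : A -> bop H H).

(* The completed tensor product of E and H over sigma. These properties
   determine it up to a unique unitary fixing the elementary tensors. *)
Record int_tensor (E : corr) := IntTensor {
  it_car :> hilbertType R;
  tens : E -> H -> it_car;
  tens_linl : forall h, linear (tens^~ h);
  tens_linr : forall x, linear (tens x);
  tens_dot : forall x h y l,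
    hdot (tens x h) (tens y l) = hdot h (sigma (cdot x y) l);
  tens_total : dense (lspan [set v | exists x h, v = tens x h])
}.

(* Such a tensor product exists for the correspondences at hand;
   in general it is obtained by completing the algebraic tensor product. *)
Lemma int_tensor_autcorr (alpha : star_aut) :
  star_rep sigma -> nondegenerate_rep sigma -> inhabited (int_tensor (autcorr alpha)).
Proof.
move=> [slin smul sadj] snd.
apply: (inhabits (@IntTensor (autcorr alpha) H (fun a h => sigma a h) _ _ _ snd)).
- by move=> h c x y; rewrite /= slin.
- by move=> x c h l; rewrite /= linearP.
- by move=> x h y l; rewrite sadj smul.
Qed.

(* The norm of an n x n matrix over E is its norm as an operator from the
   Hilbert module A^n to E^n, where c in A^n has norm
   `|\sum_j star (c j) (c j)| ^ (1/2); this is the operator space structure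
   that E has as a corner of its linking algebra. The norm of an n x n matrix
   of operators on H is its norm as an operator on the n-fold sum of H. *)
Definition corr_mxnorm_le (E : corr) n (xi : 'I_n -> 'I_n -> E) (r : C) :=
  forall c : 'I_n -> A,
    let v i := \sum_(j < n) ract (xi i j) (c j) in
    `|\sum_(i < n) cdot (v i) (v i)|
      <= r ^+ 2 * `|\sum_(j < n) amul (star (c j)) (c j)|.

Definition bop_mxnorm_le n (f : 'I_n -> 'I_n -> bop H H) (r : C) :=
  forall h : 'I_n -> H,
    \sum_(i < n) `|\sum_(j < n) f i j (h j)| ^+ 2
      <= r ^+ 2 * \sum_(j < n) `|h j| ^+ 2.

Definition completely_contractive (E : corr) (T : E -> bop H H) :=
  forall n (xi : 'I_n -> 'I_n -> E) (r : C), 0 <= r ->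
    corr_mxnorm_le xi r -> bop_mxnorm_le (fun i j => T (xi i j)) r.

Definition covariant (E : corr) (T : E -> bop H H) :=
  forall a x b, T (lact a (ract x b)) =1 sigma a \o T x \o sigma b.

(* The operators below are the unique bounded operators with the prescribed
   values on a total set of elementary tensors. *)

Definition tilde (E : corr) (X : int_tensor E) (T : E -> bop H H) : bop X H :=
  get [set f : bop X H | forall x h, f (tens X x h) = T x h].

Definition tens_op (E F : corr) (X : int_tensor E) (Y : int_tensor F)
    (t : bop E F) (u : bop H H) : bop X Y :=
  get [set f : bop X Y | forall x h, f (tens X x h) = tens Y (t x) (u h)].

(* I_E (x) u *)
Definition amp (E : corr) (X : int_tensor E) (u : bop H H) : bop X X :=
  get [set f : bop X X | forall x h, f (tens X x h) = tens X x (u h)].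

Section Balanced.
Variables (E F G : corr) (m : E -> F -> G).
Variables (XE : int_tensor E) (XF : int_tensor F) (XG : int_tensor G).

(* When m exhibits G as the balanced tensor product of E and F, the tensor
   product of G and H is that of E and (F (x) H): [cre x w] is x (x) w. *)
Definition cre (x : E) : bop XF XG :=
  get [set f : bop XF XG | forall y h, f (tens XF y h) = tens XG (m x y) h].

(* I_E (x) v for v : F (x) H -> H *)
Definition amp_from (v : bop XF H) : bop XG XE :=
  get [set f : bop XG XE | forall x w, f (cre x w) = tens XE x (v w)].

(* I_E (x) v for v : H -> F (x) H *)
Definition amp_to (v : bop H XF) : bop XE XG :=
  get [set f : bop XE XG | forall x h, f (tens XE x h) = cre x (v h)].

End Balanced.
End Representations.

(* The part of a product system over N^k that representations refer to:
   the generating fibers, their balanced tensor products and the flips, without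
   the laws relating them. *)
Record prod_sys_data (k : nat) := ProdSysData {
  fib : 'I_k -> corr;
  fib2 : 'I_k -> 'I_k -> corr;
  bal : forall i j, fib i -> fib j -> fib2 i j;
  flip : forall i j, bop (fib2 i j) (fib2 j i)
}.

Section Automorphic.
Variables (k : nat) (alpha : 'I_k -> star_aut).

Definition aut_fib2 (i j : 'I_k) : corr :=
  autcorr (aut_comp (alpha j) (alpha i)).

(* a (x) b is identified with alpha_j(a) b *)
Definition aut_bal (i j : 'I_k) (a : autcorr (alpha i)) (b : autcorr (alpha j)) :
  aut_fib2 i j := amul (alpha j a) b.

Definition aut_flip (i j : 'I_k) : bop (aut_fib2 i j) (aut_fib2 j i) :=
  get [set t : bop (aut_fib2 i j) (aut_fib2 j i) | forall a b,
    t (@aut_bal i j a b) = @aut_bal j i (aut_inv (alpha i) (alpha j a)) b].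

Definition aut_sys : prod_sys_data k := ProdSysData aut_bal aut_flip.

End Automorphic.

Section DoublyTwisted.
Variables (k : nat) (P : prod_sys_data k) (H : hilbertType R).
Variables (sigma : A -> bop H H) (T : forall i, fib P i -> bop H H).
Variable U : 'I_k -> 'I_k -> bop H H.
Variables (X : forall i, int_tensor sigma (fib P i)).
Variables (XX : forall i j, int_tensor sigma (fib2 P i j)).

Let Tt i : bop (X i) H := tilde (X i) (@T i).
(* I_{E_i} (x) T~_j *)
Let ITt i j : bop (XX i j) (X i) := amp_from (@bal k P i j) (X i) (XX i j) (Tt j).
(* I_{E_i} (x) T~_j^* *)
Let ITts i j : bop (X i) (XX i j) :=
  amp_to (@bal k P i j) (X i) (XX i j) (adj (Tt j)).
Let twist i j : bop (XX i j) (XX j i) :=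
  tens_op (XX i j) (XX j i) (flip P i j) (U i j).

Definition doubly_twisted : Prop :=
  [/\ forall i, [/\ op_linear (@T i), completely_contractive (@T i) &
                    covariant sigma (@T i)],
      forall i j, i != j ->
        [/\ unitary (U i j), U j i =1 adj (U i j),
            forall l, U i j \o Tt l =1 Tt l \o amp (X l) (U i j) &
            forall a, U i j \o sigma a =1 sigma a \o U i j],
      forall i j, i != j -> Tt i \o ITt i j =1 Tt j \o ITt j i \o twist i j &
      forall i j, i != j ->
        adj (Tt j) \o Tt i =1 ITt j i \o twist i j \o ITts i j].

End DoublyTwisted.
End Algebras.

(* Main.v *)
From HB Require Import structures.
Require Import Defs.
From mathcomp Require Import all_boot all_order all_algebra.
From mathcomp Require Import complex ring lra.
From mathcomp Require Import boolp classical_sets functions cardinality reals.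
From mathcomp Require Import topology normedtype.

(* All the tensor products are identified with H, by a (x) h |-> sigma a h, and
   the flips with the identity of A.  The two defining relations of a doubly
   twisted representation then read S_i S_j = S_j S_i U_ij and
   S_j^* S_i = S_i U_ij S_j^*, so that both directions come down to relating
   T_i and S_i.

   From T_i to S_i: if e runs through elements of the unit ball of A with
   e a -> a, then sum_l T_i(a_l) h_l is the limit of
   T_i(e) (sum_l sigma(a_l) h_l), whence |sum_l T_i(a_l) h_l| <=
   |sum_l sigma(a_l) h_l|, and S_i : sigma(a) h |-> T_i(a) h is a well-defined
   contraction on a dense subspace.

   From S_i to T_i: it must be shown that sigma is completely contractive.

   No order or functional calculus on A is used; in particular the positivity of
   a^* a and the positivity of sums are never needed.  They are replaced by the
   solution c of (1 - c)^2 = 1 - b, given for |b| < 1 by a contracting iteration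
   in A or in the matrices over A.  For a self-adjoint x with |x| < 1 it yields
   a unitary u = x + i (1 - x^2)^(1/2) of the unitization, hence norm bounds for
   the Chebyshev polynomials of x, hence approximate units. *)

Set Implicit Arguments.
Unset Strict Implicit.
Unset Printing Implicit Defensive.

Import Order.TTheory GRing.Theory Num.Theory.
Import numFieldNormedType.Exports.

Local Open Scope classical_set_scope.
Local Open Scope complex_scope.
Local Open Scope ring_scope.
Local Notation Re := complex.Re.

(** * Linear combinations in a module *)

(** Syntax for a reflective decision procedure: [LVar n] stands for the atom at position [n] of an
    environment. *)
Inductive lexpr (K : Type) :=
  LVar of nat | LZero | LAdd of lexpr K & lexpr K | LOpp of lexpr K
| LScale of K & lexpr K.
Arguments LVar {K}.
Arguments LZero {K}.

Section LinearCombinations.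
Variables (K : pzRingType) (V : lmodType K).

Fixpoint leval (env : seq V) (e : lexpr K) : V :=
  match e with
  | LVar n => nth 0 env n
  | LZero => 0
  | LAdd e1 e2 => leval env e1 + leval env e2
  | LOpp e1 => - leval env e1
  | LScale c e1 => c *: leval env e1
  end.

Fixpoint lcoef (i : nat) (e : lexpr K) : K :=
  match e with
  | LVar n => if eqn i n then 1 else 0
  | LZero => 0
  | LAdd e1 e2 => lcoef i e1 + lcoef i e2
  | LOpp e1 => - lcoef i e1
  | LScale c e1 => c * lcoef i e1
  end.

Lemma levalE env e : leval env e = \sum_(i < size env) lcoef i e *: nth 0 env i.
Proof.
elim: e => [n||e1 IH1 e2 IH2|e IH|c e IH] /=.
- have [nlt|nge] := ltnP n (size env).
    rewrite (bigD1 (Ordinal nlt)) //= eqnE eqxx scale1r big1 ?addr0 // => i.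
    by rewrite -val_eqE /= => /negPf; rewrite -eqnE => ->; rewrite scale0r.
  rewrite nth_default // big1 // => i _.
  by rewrite eqnE ltn_eqF ?scale0r // (leq_trans (ltn_ord i)).
- by rewrite big1 // => i _; rewrite scale0r.
- by rewrite IH1 IH2 -big_split; apply: eq_bigr => i _; rewrite scalerDl.
- by rewrite IH -sumrN; apply: eq_bigr => i _; rewrite scaleNr.
- by rewrite IH scaler_sumr; apply: eq_bigr => i _; rewrite scalerA.
Qed.

(** A recursive conjunction, so that on a concrete environment it computes to one scalar goal per
    atom, which [lc_coefs] can split off. *)
Fixpoint lcoefs_eq n (e1 e2 : lexpr K) : Prop :=
  if n is m.+1 then lcoef m e1 = lcoef m e2 /\ lcoefs_eq m e1 e2 else True.

Lemma leval_eq env e1 e2 : lcoefs_eq (size env) e1 e2 ->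
  leval env e1 = leval env e2.
Proof.
rewrite !levalE => h; apply: eq_bigr => i _; congr (_ *: _).
elim: (size env) h (i : nat) (ltn_ord i) => // n IH [hn h] j.
by rewrite ltnS leq_eqVlt => /predU1P[-> //|]; apply: IH.
Qed.
End LinearCombinations.

(** The matches on [constr:(Set)] allow [unify] to run while a term is being built; its failure
    selects the next branch. Atoms are thus compared by unification, not only syntactically. *)
Ltac lc_mem x l :=
  lazymatch l with
  | nil => constr:(false)
  | cons ?y ?t => match constr:(Set) with
                  | _ => let _ := match constr:(Set) with _ => unify x y end in
                         constr:(true)
                  | _ => lc_mem x t
                  end
  end.
Ltac lc_idx x l :=
  lazymatch l with
  | cons ?y ?t => match constr:(Set) with
                  | _ => let _ := match constr:(Set) with _ => unify x y end in
                         constr:(O)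
                  | _ => let n := lc_idx x t in constr:(S n)
                  end
  end.
Ltac lc_atoms t l :=
  lazymatch t with
  | GRing.add ?a ?b => let l1 := lc_atoms a l in lc_atoms b l1
  | GRing.opp ?a => lc_atoms a l
  | GRing.scale _ ?a => lc_atoms a l
  | GRing.zero => l
  | _ => let b := lc_mem t l in
         lazymatch b with true => l | false => constr:(cons t l) end
  end.
Ltac lc_reify K t l :=
  lazymatch t with
  | GRing.add ?a ?b => let x := lc_reify K a l in let y := lc_reify K b l in
                       constr:(@LAdd K x y)
  | GRing.opp ?a => let x := lc_reify K a l in constr:(@LOpp K x)
  | GRing.scale ?c ?a => let x := lc_reify K a l in constr:(@LScale K c x)
  | GRing.zero => constr:(@LZero K)
  | _ => let n := lc_idx t l in constr:(@LVar K n)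
  end.
Ltac lc_coefs :=
  lazymatch goal with
  | |- _ /\ _ => split; [solve [ring | by field] | lc_coefs]
  | |- True => constructor
  end.
(* Decides an equation between linear combinations in a left module, by
   comparing the coefficients of the atoms. *)
Tactic Notation "lcomb" constr(K) :=
  lazymatch goal with
  | |- @eq ?V ?lhs ?rhs =>
    let l := lc_atoms lhs constr:(@nil V) in
    let l := lc_atoms rhs l in
    let x := lc_reify K lhs l in
    let y := lc_reify K rhs l in
    apply: (@leval_eq _ _ l x y); cbn [size lcoefs_eq lcoef eqn];
    lc_coefs
  end.

(** * Real-valued norms and bounded operators *)

Section RealNorm.
Variable R : realType.
Local Notation C := R[i].

Section Normed.
Variable V : normedModType C.
Implicit Types x y z : V.

(** The norm read in the totally ordered field [R], where [lra] and [nra] apply. *)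
Definition nm x : R := Re `|x|.

Lemma nmE x : `|x| = (nm x)%:C.
Proof. by rewrite /nm RRe_real // normr_real. Qed.

Lemma nm_ge0 x : 0 <= nm x.
Proof. by rewrite -ler0c -nmE. Qed.

Lemma nm0 : nm (0 : V) = 0.
Proof. by rewrite /nm normr0. Qed.

Lemma nm0_eq0 x : nm x = 0 -> x = 0.
Proof. by move=> x0; apply: normr0_eq0; rewrite nmE x0. Qed.

Lemma nmD x y : nm (x + y) <= nm x + nm y.
Proof. by rewrite -lecR rmorphD /= -!nmE ler_normD. Qed.

Lemma nmN x : nm (- x) = nm x.
Proof. by rewrite /nm normrN. Qed.

Lemma nmB x y : nm (x - y) = nm (y - x).
Proof. by rewrite -nmN opprB. Qed.

Lemma nm_triangle x y z : nm (x - z) <= nm (x - y) + nm (y - z).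
Proof. by rewrite -[x - z](subrKA y) nmD. Qed.

Lemma nmZ (c : C) x : nm (c *: x) = Re `|c| * nm x.
Proof.
by rewrite {1}/nm normrZ nmE -[`|c|]RRe_real ?normr_real // -rmorphM.
Qed.

Lemma nmZR (c : R) x : 0 <= c -> nm (c%:C *: x) = c * nm x.
Proof. by move=> c0; rewrite nmZ ger0_norm // ler0c. Qed.

Lemma nm_le x y : (`|x| <= `|y|) = (nm x <= nm y).
Proof. by rewrite !nmE lecR. Qed.

Lemma nm_sum (I : Type) (s : seq I) (P : pred I) (F : I -> V) :
  nm (\sum_(i <- s | P i) F i) <= \sum_(i <- s | P i) nm (F i).
Proof.
elim/big_rec2: _ => [|i y1 y2 _ le12]; first by rewrite nm0.
by apply: le_trans (nmD _ _) _; rewrite lerD2l.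
Qed.

Lemma nm_small_eq x y : (forall e, 0 < e -> nm (x - y) <= e) -> x = y.
Proof.
move=> h; apply/subr0_eq/nm0_eq0/le_anti; rewrite nm_ge0 andbT.
by apply/ler_addgt0Pl => e e0; rewrite addr0 h.
Qed.

Lemma gt0C (e : C) : 0 < e -> exists2 r : R, 0 < r & e = r%:C.
Proof.
move=> e0; exists (Re e); last by rewrite RRe_real // gtr0_real.
by rewrite -ltcR RRe_real // gtr0_real.
Qed.

Lemma dense_nm (D : set V) : dense D ->
  forall x (e : R), 0 < e -> exists2 y, D y & nm (x - y) < e.
Proof.
move=> dD x e e0; have [|y [/= xy Dy]] := dD (ball x e%:C) _ (ball_open _ _).
  by exists x; apply: ballxx; rewrite ltcR.
exists y => //.
by move: xy; rewrite -ball_normE /= nmE ltcR.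
Qed.

End Normed.

Lemma nm_complete (V : completeNormedModType C) (u : nat -> V) :
  (forall e : R, 0 < e -> exists N, forall m n, (N <= m)%N -> (N <= n)%N ->
     nm (u m - u n) <= e) ->
  exists l, forall e : R, 0 < e -> exists N, forall n, (N <= n)%N ->
    nm (u n - l) <= e.
Proof.
move=> cu; have : cauchy (u @ \oo).
  apply: cauchy_exP => e /gt0C [r r0 ->].
  have [N hN] := cu (r / 2) (divr_gt0 r0 (ltr0Sn _ _)).
  exists (u N), N => // n /= Nn; rewrite -ball_normE /= nmE ltcR.
  apply: le_lt_trans (hN _ _ (leqnn _) Nn) _; lra.
move/cauchy_cvg/cvg_ex => [l ul]; exists l => e e0.
have eC : 0 < e%:C by rewrite ltcR.
have [N _ hN] := (proj1 (cvgrPdist_le _ _) ul) _ eC.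
by exists N => n Nn; move: (hN n Nn) => /=; rewrite nmE lecR nmB.
Qed.

Section Bounded.
Variables V W : normedModType C.

Lemma bop_bounded (f : bop V W) :
  exists2 K : R, 0 <= K & forall x, nm (f x) <= K * nm x.
Proof.
have /linear_boundedP/pinfty_ex_gt0 [M M0 fM] :
    bounded_near (f : {linear V -> W}) (nbhs 0).
  by apply/linear_bounded_continuous; exact: (@bop_continuous _ _ _ f).
have [r r0 Mr] := gt0C M0.
exists r => [|x]; first exact: ltW.
by rewrite -lecR rmorphM /= -!nmE -Mr; apply: fM.
Qed.

Lemma bop_of_bounded (f : V -> W) (K : R) : linear f ->
  (forall x, nm (f x) <= K * nm x) -> exists g : bop V W, g =1 f.
Proof.
move=> fl fK.
pose L := HB.pack_for {linear V -> W} f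
  (GRing.isLinear.Build C V W *:%R f fl).
have : continuous L.
  apply/linear_bounded_continuous/linear_boundedP.
  exists `|K|%:C; split=> [|M KM x]; first by apply: ger0_real; rewrite ler0c.
  rewrite !nmE; apply: le_trans (_ : (`|K| * nm x)%:C <= _).
    rewrite lecR; apply: le_trans (fK x) _; apply: ler_wpM2r; first exact: nm_ge0.
    exact: ler_norm.
  by rewrite rmorphM /= ler_wpM2r ?ler0c ?nm_ge0 // ltW.
by move=> fc; exists (Bop fl fc).
Qed.
End Bounded.

Section Comp.
Variables V W Z : normedModType C.

Lemma bopD (f : bop V W) x y : f (x + y) = f x + f y.
Proof. exact: linearD. Qed.
Lemma bopB (f : bop V W) x y : f (x - y) = f x - f y.
Proof. exact: linearB. Qed.
Lemma bopZ (f : bop V W) c x : f (c *: x) = c *: f x.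
Proof. exact: linearZ. Qed.
Lemma bop0 (f : bop V W) : f 0 = 0.
Proof. exact: linear0. Qed.
Lemma bop_sum (f : bop V W) I (s : seq I) (P : pred I) F :
  f (\sum_(i <- s | P i) F i) = \sum_(i <- s | P i) f (F i).
Proof. exact: linear_sum. Qed.

Lemma bop_comp (f : bop W Z) (g : bop V W) : exists h : bop V Z, h =1 f \o g.
Proof.
have [K K0 fK] := bop_bounded f; have [L L0 gL] := bop_bounded g.
apply: (@bop_of_bounded _ _ _ (K * L)) => [c x y|x] /=.
  by rewrite !(bop_linear g, bop_linear f).
by apply: le_trans (fK _) _; rewrite -mulrA; apply: ler_wpM2l.
Qed.

Lemma bop_eq_dense (D : set V) (f g : bop V W) : dense (lspan D) ->
  (forall x, D x -> f x = g x) -> f =1 g.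
Proof.
move=> dD fg x; have [K K0 fK] := bop_bounded f; have [L L0 gL] := bop_bounded g.
apply: nm_small_eq => e e0.
have e1 : 0 < e / (K + L + 1) by apply: divr_gt0; lra.
have [_ [n [c [d [Dd ->]]]]] := dense_nm dD x e1.
set y := \sum_(i < n) _ => xy.
have fgy : f y = g y.
  by rewrite !bop_sum; apply: eq_bigr => i _; rewrite !bopZ fg.
rewrite (_ : f x - g x = f (x - y) - g (x - y)); last first.
  by rewrite !bopB fgy opprB addrA subrK.
apply: le_trans (nmD _ _) _; rewrite nmN.
apply: le_trans (lerD (fK _) (gL _)) _; rewrite -mulrDl.
apply: le_trans (_ : (K + L + 1) * nm (x - y) <= _).
  by apply: ler_wpM2r; [exact: nm_ge0|lra].
by rewrite mulrC -ler_pdivlMr ?ltW //; lra.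
Qed.
End Comp.

End RealNorm.

Lemma archi_inv (R : realType) (e : R) : 0 < e ->
  exists N, forall n, (N <= n)%N -> n.+1%:R^-1 <= e.
Proof.
move=> e0; exists (Num.bound e^-1) => n Nn.
have /ltW h : e^-1 < n.+1%:R.
  apply: lt_le_trans (archi_boundP _) _; first by rewrite invr_ge0 ltW.
  by rewrite ler_nat (leq_trans Nn).
by rewrite -[e]invrK lef_pV2 // posrE ?invr_gt0 ?ltr0Sn.
Qed.

Lemma Re_norm_ge0 (R : realType) (z : R[i]) : 0 <= Re `|z|.
Proof. by rewrite -ler0c RRe_real ?normr_real. Qed.

(** * Extension of densely defined bounded operators *)

Section Extension.
Variable R : realType.
Local Notation C := R[i].
Variables (V : normedModType C) (W : completeNormedModType C).

(** [P] is the graph of a densely defined operator, given as a relation: that it is single-valued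
    follows from linearity and the bound. The graph of the extension is the closure [G] of [P]. *)
Lemma bop_extend (P : V -> W -> Prop) (K : R) :
  (forall c x y x' y', P x y -> P x' y' -> P (c *: x + x') (c *: y + y')) ->
  (forall x e, 0 < e -> exists x' y', P x' y' /\ nm (x - x') <= e) ->
  0 <= K -> (forall x y, P x y -> nm y <= K * nm x) ->
  exists f : bop V W, forall x y, P x y -> f x = y.
Proof.
move=> Plin Pd K0 PK.
pose G v w := forall e : R, 0 < e ->
  exists x y, [/\ P x y, nm (v - x) <= e & nm (w - y) <= e].
have GP x y : P x y -> G x y.
  by move=> Pxy e e0; exists x, y; rewrite !subrr !nm0 ltW.
have Glin c v w v' w' : G v w -> G v' w' -> G (c *: v + v') (c *: w + w').
  move=> Gv Gv' e e0; set k := Re `|c|.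
  have k0 : 0 <= k by exact: Re_norm_ge0.
  have e1 : 0 < e / (k + 1) by apply: divr_gt0; lra.
  have e2 : e / (k + 1) * (k + 1) = e by rewrite divfK //; lra.
  have [x [y [Pxy vx wy]]] := Gv _ e1; have [x' [y' [Pxy' vx' wy']]] := Gv' _ e1.
  have est (Z : normedModType C) (a b a' b' : Z) : nm (a - b) <= e / (k + 1) ->
      nm (a' - b') <= e / (k + 1) -> nm (c *: a + a' - (c *: b + b')) <= e.
    move=> h h'; rewrite opprD addrACA -scalerBr.
    apply: le_trans (nmD _ _) _; rewrite nmZ -/k -e2.
    by have := ler_wpM2l k0 h; lra.
  by exists (c *: x + x'), (c *: y + y'); split; [exact: Plin|exact: est|exact: est].
have GK v w : G v w -> nm w <= K * nm v.
  move=> Gv; apply/ler_addgt0Pl => e e0.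
  have e1 : 0 < e / (K + 1) by apply: divr_gt0; lra.
  have e2 : e / (K + 1) * (K + 1) = e by rewrite divfK //; lra.
  have [x [y [/PK Pxy vx wy]]] := Gv _ e1.
  have h1 := nmD (w - y) y; rewrite subrK in h1.
  have h2 := nmD (x - v) v; rewrite subrK nmB in h2.
  have h3 : nm x <= e / (K + 1) + nm v by lra.
  by have := ler_wpM2l K0 h3; lra.
(* The difference of two values at [v] is a value at 0, so its norm is at most [K * 0]. *)
have Gfun v w w' : G v w -> G v w' -> w = w'.
  move=> Gv Gv'; have /GK := Glin (-1) _ _ _ _ Gv Gv'.
  rewrite !scaleN1r addNr nm0 mulr0 => h; apply/esym/subr0_eq/nm0_eq0/le_anti.
  by rewrite nm_ge0 addrC h.
(* Approximations of [v] within [1/(n+1)] have images that form a Cauchy sequence, by the bound on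
   [P]. *)
have Gtot v : exists w, G v w.
  have /choice [xy hxy] : forall n, exists p : V * W,
      P p.1 p.2 /\ nm (v - p.1) <= n.+1%:R^-1.
    by move=> n; have [x [y h]] := Pd v n.+1%:R^-1 ltac:(by rewrite invr_gt0);
      exists (x, y).
  have yC e : 0 < e -> exists N, forall m n, (N <= m)%N -> (N <= n)%N ->
      nm ((xy m).2 - (xy n).2) <= e.
    move=> e0; have e1 : 0 < e / (2 * (K + 1)) by apply: divr_gt0; lra.
    have e2 : e / (2 * (K + 1)) * (2 * (K + 1)) = e by rewrite divfK //; lra.
    have [N hN] := archi_inv e1; exists N => m n Nm Nn.
    have [[Pm vm] [Pn vn]] := (hxy m, hxy n).
    have := PK _ _ (Plin (-1) _ _ _ _ Pm Pn).
    rewrite !scaleN1r ![- _ + _]addrC nmB => /le_trans; apply.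
    have h := nm_triangle (xy n).1 v (xy m).1; rewrite (nmB _ v) in h.
    have h1 := lerD (le_trans vn (hN _ Nn)) (le_trans vm (hN _ Nm)).
    have := ler_wpM2l K0 (le_trans h h1).
    by have := hN _ Nn; lra.
  have [w hw] := nm_complete yC; exists w => e e0.
  have [N1 h1] := hw _ e0; have [N2 h2] := archi_inv e0.
  have [Pn vn] := hxy (maxn N1 N2).
  exists (xy (maxn N1 N2)).1, (xy (maxn N1 N2)).2; split=> //.
    by apply: le_trans vn (h2 _ _); rewrite leq_maxr.
  by rewrite nmB h1 // leq_maxl.
have [f hf] := choice Gtot.
have fl : linear f by move=> c x y; apply: Gfun (hf _) (Glin _ _ _ _ _ _ _).
have [g gf] := bop_of_bounded fl (fun x => GK _ _ (hf x)).
by exists g => x y /GP; rewrite gf; apply: Gfun.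
Qed.

End Extension.

(** * Hilbert spaces *)

Section Hilbert.
Variable R : realType.
Local Notation C := R[i].

Section Dot.
Variable H : hilbertType R.
Implicit Types x y z : H.

Lemma hdotDr x y z : hdot x (y + z) = hdot x y + hdot x z.
Proof. by have := hdotP x 1 y z; rewrite scale1r mul1r. Qed.
Lemma hdot0r x : hdot x 0 = 0.
Proof. by apply: (addrI (hdot x 0)); rewrite -hdotDr !addr0. Qed.
Lemma hdotZr c x y : hdot x (c *: y) = c * hdot x y.
Proof. by have := hdotP x c y 0; rewrite hdot0r !addr0. Qed.
Lemma hdotNr x y : hdot x (- y) = - hdot x y.
Proof. by rewrite -scaleN1r hdotZr mulN1r. Qed.
Lemma hdotDl x y z : hdot (y + z) x = hdot y x + hdot z x.
Proof. by rewrite hdotC hdotDr rmorphD /= -!hdotC. Qed.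
Lemma hdotZl c x y : hdot (c *: y) x = Num.conj c * hdot y x.
Proof. by rewrite hdotC hdotZr rmorphM /= -!hdotC. Qed.
Lemma hdotNl x y : hdot (- y) x = - hdot y x.
Proof. by rewrite hdotC hdotNr rmorphN /= -!hdotC. Qed.
Lemma hdot0l x : hdot 0 x = 0.
Proof. by rewrite hdotC hdot0r rmorph0. Qed.
Lemma hdot_sumr x I (s : seq I) (P : pred I) (F : I -> H) :
  hdot x (\sum_(i <- s | P i) F i) = \sum_(i <- s | P i) hdot x (F i).
Proof. by apply: (big_morph (hdot x) (hdotDr x) (hdot0r x)). Qed.
Lemma hdot_suml x I (s : seq I) (P : pred I) (F : I -> H) :
  hdot (\sum_(i <- s | P i) F i) x = \sum_(i <- s | P i) hdot (F i) x.
Proof. by apply: (big_morph (hdot^~ x) (hdotDl x) (hdot0l x)). Qed.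

Lemma hdot_nm x : hdot x x = (nm x ^+ 2)%:C.
Proof. by rewrite hdot_norm nmE rmorphXn. Qed.

Lemma Re_conj (z : C) : Re (Num.conj z) = Re z.
Proof. by case: z. Qed.

(** The inner product of the underlying real Hilbert space; it induces the same norm and keeps
    estimates inside [R]. *)
Definition rdot x y : R := Re (hdot x y).

Lemma rdotC x y : rdot x y = rdot y x.
Proof. by rewrite /rdot [hdot y x]hdotC Re_conj. Qed.
Lemma rdotxx x : rdot x x = nm x ^+ 2.
Proof. by rewrite /rdot hdot_nm. Qed.
Lemma rdotDr x y z : rdot x (y + z) = rdot x y + rdot x z.
Proof. by rewrite /rdot hdotDr raddfD. Qed.
Lemma rdotNr x y : rdot x (- y) = - rdot x y.
Proof. by rewrite /rdot hdotNr raddfN. Qed.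
Lemma rdotBr x y z : rdot x (y - z) = rdot x y - rdot x z.
Proof. by rewrite rdotDr rdotNr. Qed.
Lemma rdotDl x y z : rdot (y + z) x = rdot y x + rdot z x.
Proof. by rewrite rdotC rdotDr !(rdotC x). Qed.
Lemma rdotBl x y z : rdot (y - z) x = rdot y x - rdot z x.
Proof. by rewrite rdotC rdotBr !(rdotC x). Qed.
Lemma Re_ZR (c : R) (z : C) : Re (c%:C * z) = c * Re z.
Proof. by case: z => a b /=; rewrite mul0r subr0. Qed.
Lemma rdotZr (c : R) x y : rdot x (c%:C *: y) = c * rdot x y.
Proof. by rewrite /rdot hdotZr Re_ZR. Qed.

Lemma nmD_sqr x y : nm (x + y) ^+ 2 = nm x ^+ 2 + 2 * rdot x y + nm y ^+ 2.
Proof. by rewrite -!rdotxx rdotDr !rdotDl (rdotC y x); ring. Qed.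

Lemma nmB_sqr x y : nm (x - y) ^+ 2 = nm x ^+ 2 - 2 * rdot x y + nm y ^+ 2.
Proof. by rewrite nmD_sqr rdotNr nmN; ring. Qed.

Lemma quad_ge0_eq0 (d B : R) :
  (forall t, 0 <= 2 * t * d + t ^+ 2 * B) -> 0 <= B -> d = 0.
Proof.
move=> h B0; have B1 : B + 1 != 0 by lra.
(* Close to the minimiser [- d / B], with [B + 1] in the denominator because [B] may vanish; the
   value there is negative unless [d = 0]. *)
have := h (- d / (B + 1)).
rewrite (_ : _ + _ = - (d / (B + 1)) ^+ 2 * (B + 2)); last by field.
move=> h1; have : (d / (B + 1)) ^+ 2 <= 0 by have := sqr_ge0 (d / (B + 1)); nra.
rewrite le_eqVlt ltNge sqr_ge0 orbF sqrf_eq0 mulf_eq0 invr_eq0 (negPf B1).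
by rewrite orbF => /eqP.
Qed.

Lemma rdot_le x y : rdot x y <= nm x * nm y.
Proof.
have [/nm0_eq0 ->|y0] := eqVneq (nm y) 0.
  by rewrite nm0 mulr0 /rdot hdot0r.
have [x0|x0] := eqVneq (nm x) 0.
  by rewrite x0 mul0r (nm0_eq0 x0) /rdot hdot0l.
have := sqr_ge0 (nm ((nm y)%:C *: x - (nm x)%:C *: y)).
rewrite nmB_sqr !nmZR ?nm_ge0 // rdotZr rdotC rdotZr rdotC.
have : 0 < nm x * nm y by rewrite mulr_gt0 // lt_neqAle eq_sym nm_ge0 ?x0 ?y0.
nra.
Qed.

Lemma hdot_inj x y : (forall w, hdot x w = hdot y w) -> x = y.
Proof.
move=> h; apply/subr0_eq/nm0_eq0/eqP; rewrite -sqrf_eq0 -rdotxx /rdot.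
by rewrite hdotDl hdotNl h subrr.
Qed.

(** Variational proof: the representing vector minimises [J x = |x|^2 - 2 Re (phi x)], and a
    minimising sequence is Cauchy by the parallelogram law. *)
Lemma riesz (phi : H -> C) (K : R) : linear_for *%R phi ->
  (forall x, Re (phi x) <= K * nm x) -> exists z, forall w, phi w = hdot z w.
Proof.
move=> phil phiK; pose f x : R := Re (phi x).
have fD x y : f (x + y) = f x + f y.
  by have := phil 1 x y; rewrite /f scale1r mul1r => ->; rewrite raddfD.
have phiZ c x : phi (c *: x) = c * phi x.
  have phi0 : phi 0 = 0.
    by have := phil (-1) 0 0; rewrite scaler0 addr0 mulN1r addNr.
  by have := phil c x 0; rewrite phi0 !addr0.
have fZ (c : R) x : f (c%:C *: x) = c * f x by rewrite /f phiZ Re_ZR.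
pose J x := nm x ^+ 2 - 2 * f x.
have Jlb x : - K ^+ 2 <= J x.
  by rewrite /J; have := phiK x; rewrite -/(f x); have := sqr_ge0 (nm x - K); nra.
have hinf : has_inf (range J).
  by split; [exists (J 0), 0|exists (- K ^+ 2) => _ [x _ <-]].
set m := inf (range J).
have mJ x : m <= J x by apply: ge_inf; [exact: hinf.2|exists x].
have /choice [u hu] : forall n, exists x, J x <= m + n.+1%:R^-1.
  move=> n; have n0 : 0 < n.+1%:R^-1 :> R by rewrite invr_gt0 ltr0Sn.
  have [_ [x _ <-] /ltW h] := inf_adherent n0 hinf.
  by exists x.
(* Parallelogram law, with [J >= m] applied at the midpoint of [x] and [y]. *)
have par x y : nm (x - y) ^+ 2 <= 2 * (J x - m) + 2 * (J y - m).
  have := mJ (2^-1%:C *: (x + y)); rewrite /J nmZR ?invr_ge0 // fZ fD exprMn.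
  by rewrite (nmB_sqr x) (nmD_sqr x); lra.
have [l hl] : exists l, forall e : R, 0 < e -> exists N, forall n, (N <= n)%N ->
    nm (u n - l) <= e.
  apply: nm_complete => e e0.
  have e1 : 0 < e ^+ 2 / 4 by rewrite divr_gt0 ?exprn_gt0.
  have [N hN] := archi_inv e1; exists N => i j Ni Nj.
  rewrite -(@ler_pXn2r _ 2) ?nnegrE ?nm_ge0 ?(ltW e0) //.
  apply: le_trans (par _ _) _.
  have hJ n : (N <= n)%N -> J (u n) <= m + e ^+ 2 / 4.
    by move=> Nn; apply: le_trans (hu n) _; rewrite lerD2l hN.
  by have := hJ _ Ni; have := hJ _ Nj; lra.
have fl w : f w = rdot l w.
  (* First variation of [J] at [l] in the direction [w]. It is computed at a nearby [u n], at the
     cost of [J (u n) - m] and [k * nm (u n - l)]. *)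
  apply/esym/subr0_eq; apply: (@quad_ge0_eq0 _ (nm w ^+ 2)); last exact: sqr_ge0.
  move=> t; apply/ler_addgt0Pl => e e0.
  pose k : R := 2 * `|t| * nm w.
  have k0 : 0 <= k by rewrite !mulr_ge0 ?nm_ge0.
  have e1 : 0 < e / (k + 1) by apply: divr_gt0; lra.
  have e2 : e / (k + 1) * (k + 1) = e by rewrite divfK //; lra.
  have [N1 h1] := hl _ e1; have [N2 h2] := archi_inv e1.
  set n := maxn N1 N2.
  have {h1} h1 : nm (u n - l) <= e / (k + 1) by apply: h1; rewrite leq_maxl.
  have {h2} h2 : n.+1%:R^-1 <= e / (k + 1) by apply: h2; rewrite leq_maxr.
  have := mJ (u n + t%:C *: w); rewrite /J fD fZ nmD_sqr rdotZr.
  have : J (u n) <= m + e / (k + 1) by apply: le_trans (hu n) _; rewrite lerD2l.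
  rewrite /J.
  have -> : nm (t%:C *: w) ^+ 2 = t ^+ 2 * nm w ^+ 2.
    by rewrite -!rdotxx rdotZr rdotC rdotZr rdotxx; ring.
  have : 2 * t * (rdot (u n) w - rdot l w) <= k * nm (u n - l).
    rewrite -rdotBl /k.
    have {1}-> : t = Num.sg t * `|t| by rewrite -numEsg.
    have : Num.sg t * rdot (u n - l) w <= nm (u n - l) * nm w.
      have a := rdot_le (u n - l) w; have b := rdot_le (u n - l) (- w).
      rewrite rdotNr nmN in b; have c := mulr_ge0 (nm_ge0 (u n - l)) (nm_ge0 w).
      by case: sgrP => _; rewrite ?mul0r ?mul1r ?mulN1r.
    by have := normr_ge0 t; nra.
  have := ler_wpM2l k0 h1; lra.
exists l => w.
(* The real parts at [w] and at [i w] determine both components of the value at [w]. *)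
have := fl w; have := fl ('i%C *: w); rewrite /f /rdot phiZ hdotZr.
case: (phi w) (hdot l w) => [a b] [c d] /=.
by rewrite !mul0r !mul1r !sub0r => /oppr_inj -> ->.
Qed.

End Dot.

Section Adjoint.
Variables H K : hilbertType R.

(** [adj] is selected by [get], so its defining property rests on existence: Riesz applied to
    [x |-> hdot y (f x)] for each [y]. *)
Lemma adjE (f : bop H K) x y : hdot (adj f y) x = hdot y (f x).
Proof.
have [M M0 fM] := bop_bounded f.
suff /getPex/(_ x y) : exists g : bop K H, forall x y, hdot (g y) x = hdot y (f x).
  by [].
have /choice [g hg] : forall y, exists z, forall x, hdot y (f x) = hdot z x.
  move=> {}y; apply: (@riesz _ _ (nm y * M)) => [c u v|u].
    by rewrite bopD bopZ hdotDr hdotZr.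
  apply: le_trans (rdot_le _ _) _; rewrite -mulrA.
  by apply: ler_wpM2l; [exact: nm_ge0|exact: fM].
have gl : linear g.
  move=> c u v; apply: hdot_inj => w.
  by rewrite -hg !hdotDl !hdotZl -!hg.
have gM u : nm (g u) <= M * nm u.
  have [/nm0_eq0 ->|g0] := eqVneq (nm (g u)) 0.
    by rewrite nm0 mulr_ge0 ?nm_ge0.
  have : nm (g u) ^+ 2 <= nm u * (M * nm (g u)).
    rewrite -rdotxx {1}/rdot -hg; apply: le_trans (rdot_le _ _) _.
    by apply: ler_wpM2l; [exact: nm_ge0|exact: fM].
  have : 0 < nm (g u) by rewrite lt_neqAle eq_sym g0 nm_ge0.
  by move=> g1 h; rewrite -(ler_pM2r g1); lra.
have [h hgE] := bop_of_bounded gl gM.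
by exists h => a b; rewrite hgE -hg.
Qed.

End Adjoint.

End Hilbert.

(** * Geometric convergence *)

Section Geometric.
Variable R : realType.
Local Notation C := R[i].

Lemma exp_small (q K e : R) : 0 <= q -> q < 1 -> 0 < e ->
  exists N, forall n, (N <= n)%N -> K * q ^+ n <= e.
Proof.
move=> q0 q1 e0.
(* A form of Bernoulli's inequality, making [q ^+ n] of order [1/n]. *)
have bern n : q ^+ n * (1 + n%:R * (1 - q)) <= 1.
  elim: n => [|n IH]; first by rewrite expr0 mul0r addr0 mulr1.
  have h : q ^+ n.+1 <= 1 by rewrite exprn_ile1 // ltW.
  rewrite exprS -natr1; rewrite exprS in h.
  have := ler_wpM2l q0 IH; have : 0 <= 1 - q by lra.
  by move=> h1; have := ler_wpM2r h1 h; nra.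
pose L : R := `|K| + 1; have L0 : 0 < L by rewrite ltr_wpDl.
have d0 : 0 < e * (1 - q) / L by rewrite divr_gt0 // mulr_gt0 // subr_gt0.
have [N hN] := archi_inv d0; exists N.+1 => -[//|n] Nn.
have {hN} := hN n Nn; set a : R := n.+1%:R; have a0 : 0 < a by rewrite ltr0Sn.
rewrite ler_pdivlMr // ler_pdivrMl // => h.
have := bern n.+1; rewrite -/a; set p := q ^+ _ => hb.
have p0 : 0 <= p by rewrite exprn_ge0.
have h2 : p * L <= p * (a * (e * (1 - q))) by rewrite ler_wpM2l.
have h3 : K * p <= p * L by rewrite mulrC ler_wpM2l // /L; have := ler_norm K; lra.
have h4 : p * a * (1 - q) <= 1 by lra.
by have := ler_wpM2l (ltW e0) h4; lra.
Qed.

Lemma le_exp_le (q K x y : R) : 0 <= q -> q < 1 ->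
  (forall n, x <= y + K * q ^+ n) -> x <= y.
Proof.
move=> q0 q1 h; apply/ler_addgt0Pr => e e0.
have [N hN] := exp_small K q0 q1 e0.
by apply: le_trans (h N) _; rewrite lerD2l hN.
Qed.

Lemma geo_limit (V : completeNormedModType C) (u : nat -> V) (q K : R) :
  0 <= q -> q < 1 -> 0 <= K ->
  (forall n, nm (u n.+1 - u n) <= K * q ^+ n) ->
  exists l, forall n, nm (u n - l) <= K / (1 - q) * q ^+ n.
Proof.
move=> q0 q1 K0 h; have q2 : 0 < 1 - q by rewrite subr_gt0.
pose L := K / (1 - q); have LK : L * (1 - q) = K by rewrite divfK // gt_eqF.
have L0 : 0 <= L by rewrite divr_ge0 // ltW.
have est n k : nm (u (n + k)%N - u n) <= L * q ^+ n.
  (* The induction on [k] needs the exact partial sum of the geometric series, the first summand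
     here. *)
  have -> : L * q ^+ n = L * q ^+ n * (1 - q ^+ k) + L * q ^+ (n + k).
    by rewrite exprD; ring.
  apply: ler_wpDr; first by rewrite mulr_ge0 // exprn_ge0.
  elim: k => [|k IH]; first by rewrite addn0 subrr nm0 expr0 subrr mulr0.
  apply: le_trans (nm_triangle _ (u (n + k)%N) _) _; rewrite addnS.
  apply: le_trans (lerD (h _) IH) _.
  by rewrite le_eqVlt; apply/orP; left; apply/eqP; rewrite -LK exprD exprS; ring.
have [l hl] : exists l, forall e : R, 0 < e -> exists N, forall n, (N <= n)%N ->
    nm (u n - l) <= e.
  apply: nm_complete => e e0.
  have [N hN] := exp_small (2 * L) q0 q1 e0; exists N => i j Ni Nj.
  apply: le_trans (nm_triangle _ (u N) _) _.
  have := est N (i - N)%N; have := est N (j - N)%N; rewrite !subnKC // [nm (u N - _)]nmB.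
  by have := hN N (leqnn _); lra.
exists l => n; apply/ler_addgt0Pr => e e0; have [N hN] := hl e e0.
apply: le_trans (nm_triangle _ (u (n + N)%N) _) _.
by rewrite nmB; apply: lerD; [exact: est|apply: hN; rewrite leq_addl].
Qed.
End Geometric.

(** * Square roots and approximate units in C*-algebras *)

Section CStarAlgebra.
Variables (R : realType) (A : cstarAlgType R).
Local Notation C := R[i].
Local Infix "**" := (@amul R A) (at level 40, left associativity).
Implicit Types a b c x y z : A.

Lemma amulDl x y z : (x + y) ** z = x ** z + y ** z.
Proof. by have := amul_linl z 1 x y; rewrite !scale1r. Qed.
Lemma amulDr x y z : z ** (x + y) = z ** x + z ** y.
Proof. by have := amul_linr z 1 x y; rewrite !scale1r. Qed.
Lemma amul0l z : 0 ** z = 0.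
Proof. by apply: (addrI (0 ** z)); rewrite -amulDl !addr0. Qed.
Lemma amul0r z : z ** 0 = 0.
Proof. by apply: (addrI (z ** 0)); rewrite -amulDr !addr0. Qed.
Lemma amulZl (k : C) x z : (k *: x) ** z = k *: (x ** z).
Proof. by have := amul_linl z k x 0; rewrite /= amul0l !addr0. Qed.
Lemma amulZr (k : C) x z : z ** (k *: x) = k *: (z ** x).
Proof. by have := amul_linr z k x 0; rewrite /= amul0r !addr0. Qed.
Lemma amulNl x z : (- x) ** z = - (x ** z).
Proof. by rewrite -scaleN1r amulZl scaleN1r. Qed.
Lemma amulNr x z : z ** (- x) = - (z ** x).
Proof. by rewrite -scaleN1r amulZr scaleN1r. Qed.
Lemma amulBl x y z : (x - y) ** z = x ** z - y ** z.
Proof. by rewrite amulDl amulNl. Qed.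
Lemma amulBr x y z : z ** (x - y) = z ** x - z ** y.
Proof. by rewrite amulDr amulNr. Qed.
Lemma amul_suml I (s : seq I) (P : pred I) (F : I -> A) z :
  (\sum_(i <- s | P i) F i) ** z = \sum_(i <- s | P i) F i ** z.
Proof. by apply: (big_morph (fun x => x ** z) (fun x y => amulDl x y z) (amul0l z)). Qed.
Lemma amul_sumr I (s : seq I) (P : pred I) (F : I -> A) z :
  z ** (\sum_(i <- s | P i) F i) = \sum_(i <- s | P i) z ** F i.
Proof. by apply: (big_morph (fun x => z ** x) (fun x y => amulDr x y z) (amul0r z)). Qed.

Lemma starD x y : star (x + y) = star x + star y.
Proof. by have := starP 1 x y; rewrite rmorph1 !scale1r. Qed.
Lemma star0 : star (0 : A) = 0.
Proof. by apply: (addrI (star 0)); rewrite -starD !addr0. Qed.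
Lemma starZ (k : C) x : star (k *: x) = Num.conj k *: star x.
Proof. by have := starP k x 0; rewrite star0 !addr0. Qed.
Lemma starN x : star (- x) = - star x.
Proof. by rewrite -scaleN1r starZ rmorphN1 scaleN1r. Qed.
Lemma starB x y : star (x - y) = star x - star y.
Proof. by rewrite starD starN. Qed.
Lemma star_sum I (s : seq I) (P : pred I) (F : I -> A) :
  star (\sum_(i <- s | P i) F i) = \sum_(i <- s | P i) star (F i).
Proof. by apply: (big_morph (@star R A) starD star0). Qed.

Lemma nmM x y : nm (x ** y) <= nm x * nm y.
Proof. by rewrite -lecR rmorphM /= -!nmE amul_norm. Qed.
Lemma nm_starM x : nm (star x ** x) = nm x ^+ 2.
Proof. by apply: (@complexI R); rewrite rmorphXn /= -!nmE star_norm. Qed.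
Lemma nm_star_le x : nm x <= nm (star x).
Proof.
have [->|x0] := eqVneq (nm x) 0; first exact: nm_ge0.
have p : 0 < nm x by rewrite lt_neqAle eq_sym x0 nm_ge0.
by rewrite -(ler_pM2r p) -expr2 -nm_starM nmM.
Qed.
Lemma nm_star x : nm (star x) = nm x.
Proof. by apply/le_anti; rewrite nm_star_le -{2}(starK x) nm_star_le. Qed.
Lemma nm_Mstar x : nm (x ** star x) = nm x ^+ 2.
Proof. by rewrite -{1}(starK x) nm_starM nm_star. Qed.

Lemma nmZ_half (V : normedModType C) (x : V) : nm (2^-1 *: x) = 2^-1 * nm x.
Proof.
have -> : 2^-1 = (2^-1)%:C :> C by rewrite fmorphV rmorph_nat.
by rewrite nmZR // invr_ge0.
Qed.

Lemma conj_half : Num.conj (2^-1 : C) = 2^-1.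
Proof. by rewrite fmorphV rmorph_nat. Qed.

(* [A] need not be a ring, so matrix.v provides no product. *)
Section Matrices.
Variable n : nat.
Local Notation M := 'M[A]_n.
Implicit Types X Y Z B : M.

Definition mm X Y : M := \matrix_(i, j) \sum_k X i k ** Y k j.
(** An entrywise l1 norm in place of the C*-norm of the matrix algebra: it is submultiplicative, and
    limits can be taken entry by entry. *)
Definition nrm X : R := \sum_i \sum_j nm (X i j).
Definition mstar X : M := \matrix_(i, j) star (X j i).

Lemma mmA X Y Z : mm X (mm Y Z) = mm (mm X Y) Z.
Proof.
apply/matrixP => i j; rewrite !mxE.
under eq_bigr do rewrite mxE amul_sumr.
under [RHS]eq_bigr do rewrite mxE amul_suml.
by rewrite exchange_big; do 2!apply: eq_bigr => ? _; rewrite amulA.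
Qed.
Lemma mmDl X Y Z : mm (X + Y) Z = mm X Z + mm Y Z.
Proof.
apply/matrixP => i j; rewrite !mxE -big_split; apply: eq_bigr => k _.
by rewrite mxE amulDl.
Qed.
Lemma mmDr X Y Z : mm Z (X + Y) = mm Z X + mm Z Y.
Proof.
apply/matrixP => i j; rewrite !mxE -big_split; apply: eq_bigr => k _.
by rewrite mxE amulDr.
Qed.
Lemma mmNl X Z : mm (- X) Z = - mm X Z.
Proof.
apply/matrixP => i j; rewrite !mxE -sumrN; apply: eq_bigr => k _.
by rewrite mxE amulNl.
Qed.
Lemma mmNr X Z : mm Z (- X) = - mm Z X.
Proof.
apply/matrixP => i j; rewrite !mxE -sumrN; apply: eq_bigr => k _.
by rewrite mxE amulNr.
Qed.
Lemma mmBl X Y Z : mm (X - Y) Z = mm X Z - mm Y Z.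
Proof. by rewrite mmDl mmNl. Qed.
Lemma mmBr X Y Z : mm Z (X - Y) = mm Z X - mm Z Y.
Proof. by rewrite mmDr mmNr. Qed.
Lemma mm0l X : mm 0 X = 0.
Proof. by apply: (addrI (mm 0 X)); rewrite -mmDl !addr0. Qed.
Lemma mm0r X : mm X 0 = 0.
Proof. by apply: (addrI (mm X 0)); rewrite -mmDr !addr0. Qed.

Lemma mstarM X Y : mstar (mm X Y) = mm (mstar Y) (mstar X).
Proof.
apply/matrixP => i j; rewrite !mxE star_sum; apply: eq_bigr => k _.
by rewrite !mxE starM.
Qed.
Lemma mstarK X : mstar (mstar X) = X.
Proof. by apply/matrixP => i j; rewrite !mxE starK. Qed.

Lemma nrm_ge0 X : 0 <= nrm X.
Proof. by do 2!apply: sumr_ge0 => ? _; apply: nm_ge0. Qed.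
Lemma nrm0 : nrm 0 = 0.
Proof. by do 2!apply: big1 => ? _; rewrite mxE nm0. Qed.
Lemma nrm_entry X i j : nm (X i j) <= nrm X.
Proof.
rewrite /nrm (bigD1 i) //= (bigD1 j) //= -addrA lerDl addr_ge0 //.
  by apply: sumr_ge0 => ? _; apply: nm_ge0.
by do 2!apply: sumr_ge0 => ? _; apply: nm_ge0.
Qed.
Lemma nrmD X Y : nrm (X + Y) <= nrm X + nrm Y.
Proof.
rewrite -big_split; apply: ler_sum => i _; rewrite -big_split /=.
by apply: ler_sum => j _; rewrite mxE nmD.
Qed.
Lemma nrmN X : nrm (- X) = nrm X.
Proof. by do 2!apply: eq_bigr => ? _; rewrite mxE nmN. Qed.
Lemma nrm0_eq0 X : nrm X <= 0 -> X = 0.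
Proof.
move=> h; apply/matrixP => i j; rewrite mxE; apply/nm0_eq0/le_anti.
by rewrite nm_ge0 (le_trans (nrm_entry _ _ _)).
Qed.
Lemma nrmM X Y : nrm (mm X Y) <= nrm X * nrm Y.
Proof.
rewrite /nrm mulr_suml; apply: ler_sum => i _.
apply: (@le_trans _ _ (\sum_j \sum_k nm (X i k) * nm (Y k j))).
  apply: ler_sum => j _; rewrite mxE; apply: le_trans (nm_sum _ _ _) _.
  by apply: ler_sum => k _; apply: nmM.
rewrite exchange_big mulr_suml; apply: ler_sum => k _ /=.
rewrite -mulr_sumr; apply: ler_wpM2l; first exact: nm_ge0.
rewrite [leRHS](bigD1 k) //= lerDl.
by do 2!apply: sumr_ge0 => ? _; apply: nm_ge0.
Qed.

Definition mhalf X : M := map_mx (fun x : A => 2^-1 *: x) X.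
Lemma mhalfB X Y : mhalf X - mhalf Y = mhalf (X - Y).
Proof. by apply/matrixP => i j; rewrite !mxE scalerBr. Qed.
Lemma nrm_half X : nrm (mhalf X) = 2^-1 * nrm X.
Proof.
rewrite /nrm mulr_sumr; apply: eq_bigr => i _; rewrite mulr_sumr.
by apply: eq_bigr => j _; rewrite mxE nmZ_half.
Qed.
Lemma mhalfMl X Y : mm (mhalf X) Y = mhalf (mm X Y).
Proof.
apply/matrixP => i j; rewrite !mxE scaler_sumr; apply: eq_bigr => k _.
by rewrite mxE amulZl.
Qed.
Lemma mhalfMr X Y : mm X (mhalf Y) = mhalf (mm X Y).
Proof.
apply/matrixP => i j; rewrite !mxE scaler_sumr; apply: eq_bigr => k _.
by rewrite mxE amulZr.
Qed.

(* In the unitization [(1 - c)^2 = 1 - b]; [c] is found as the fixed point of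
   [x |-> (b + x^2) / 2]. *)
Lemma sqrt_one_sub B (r : R) : 0 <= r -> r < 1 -> mstar B = B ->
  nrm B <= 2 * r - r ^+ 2 ->
  exists Y, [/\ mstar Y = Y, B = Y + Y - mm Y Y &
    forall Z, mm Z B = mm B Z -> mm Z Y = mm Y Z].
Proof.
move=> r0 r1 Bs Br.
pose F X := mhalf (B + mm X X); pose u m := iter m F 0.
(* The bound on [nrm B] is chosen so that the ball of radius [r] is invariant:
   [((2 r - r^2) + r^2) / 2 = r]. *)
have ur m : nrm (u m) <= r.
  elim: m => [|m IH]; first by rewrite nrm0.
  rewrite /= nrm_half; have := nrmD B (mm (u m) (u m)).
  have := nrmM (u m) (u m); have := nrm_ge0 (u m); rewrite -/(u m); nra.
(* On that ball [F] contracts by [r], as [X^2 - Y^2 = X (X - Y) + (X - Y) Y]. *)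
have FB X Y : nrm X <= r -> nrm Y <= r -> nrm (F X - F Y) <= r * nrm (X - Y).
  move=> Xr Yr; rewrite mhalfB nrm_half.
  have -> : B + mm X X - (B + mm Y Y) = mm X (X - Y) + mm (X - Y) Y.
    by rewrite mmBl mmBr opprD addrACA subrr add0r addrA subrK.
  have := nrmD (mm X (X - Y)) (mm (X - Y) Y).
  have := nrmM X (X - Y); have := nrmM (X - Y) Y; have := nrm_ge0 (X - Y); nra.
have du m : nrm (u m.+1 - u m) <= 1 * r ^+ m.
  elim: m => [|m IH]; first by rewrite subr0 expr0; apply: le_trans (ur 1) _; lra.
  have h : nrm (u m.+2 - u m.+1) <= r * nrm (u m.+1 - u m).
    exact: (FB (u m.+1) (u m) (ur m.+1) (ur m)).
  by apply: le_trans h _; rewrite exprS mulrCA; apply: ler_wpM2l.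
have /choice [l hl] : forall p : 'I_n * 'I_n, exists li : A, forall m,
    nm (u m p.1 p.2 - li) <= 1 / (1 - r) * r ^+ m.
  move=> [i j]; apply: (@geo_limit R A (fun m => u m i j)) => // m.
  apply: le_trans (du m).
  by have := nrm_entry (u m.+1 - u m) i j; rewrite mxE [X in _ + X]mxE.
pose Y : M := \matrix_(i, j) l (i, j).
pose K := \sum_(i < n) \sum_(j < n) (1 / (1 - r)).
have uY m : nrm (u m - Y) <= K * r ^+ m.
  rewrite /K mulr_suml; apply: ler_sum => i _; rewrite mulr_suml.
  by apply: ler_sum => j _; have := hl (i, j) m; rewrite !mxE.
have K0 : 0 <= K.
  by do 2!apply: sumr_ge0 => ? _; rewrite divr_ge0 // subr_ge0 ltW.
have Yr : nrm Y <= r.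
  apply: (@le_exp_le _ r K) => // m.
  have := nrmD (u m) (- (u m - Y)); rewrite nrmN opprB addrC subrK => h.
  by apply: le_trans h _; apply: lerD.
have lim (X : M) (L : R) : (forall m, nrm X <= L * r ^+ m) -> X = 0.
  by move=> h; apply/nrm0_eq0/(@le_exp_le _ r L) => // m; rewrite add0r.
have YF : Y = F Y.
  apply/subr0_eq/(lim _ (K + K)) => m.
  have -> : Y - F Y = - (u m.+1 - Y) + (F (u m) - F Y).
    by rewrite opprB addrA subrK.
  apply: le_trans (nrmD _ _) _; rewrite nrmN mulrDl; apply: lerD.
    apply: le_trans (uY _) _; apply: ler_wpM2l => //.
    by rewrite exprS ler_piMl ?exprn_ge0 // ltW.
  apply: le_trans (FB (u m) Y (ur m) Yr) _.
  by have := uY m; have := nrm_ge0 (u m - Y); nra.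
have us m : mstar (u m) = u m.
  elim: m => [|m IH]; first by apply/matrixP => i j; rewrite !mxE star0.
  apply/matrixP => i j; rewrite !mxE starZ conj_half starD.
  have /matrixP/(_ i j) := Bs; rewrite mxE => ->; congr (_ *: (_ + _)).
  have /matrixP/(_ i j) : mstar (mm (u m) (u m)) = mm (u m) (u m).
    by rewrite mstarM IH.
  by rewrite !mxE.
exists Y; split.
- apply/subr0_eq/(lim _ (K + K)) => m.
  have -> : mstar Y - Y = - mstar (u m - Y) + (u m - Y).
    apply/matrixP => i j; have /matrixP/(_ i j) := us m.
    by rewrite !mxE starB => ->; rewrite opprB addrA subrK.
  apply: le_trans (nrmD _ _) _; rewrite nrmN mulrDl; apply: lerD => //.
  have -> // : nrm (mstar (u m - Y)) = nrm (u m - Y).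
  rewrite /nrm exchange_big; do 2!apply: eq_bigr => ? _.
  by rewrite [mstar _ _ _]mxE nm_star.
- have -> : B = F Y + F Y - mm Y Y; last by rewrite -YF.
  apply/matrixP => i j; rewrite !mxE.
  set s := \sum_k _; lcomb C.
move=> Z ZB.
have uZ m : mm Z (u m) = mm (u m) Z.
  elim: m => [|m IH].
    by rewrite mm0l mm0r.
  by rewrite /= /F mhalfMl mhalfMr mmDl mmDr ZB mmA IH -mmA IH mmA.
apply/subr0_eq/(lim _ (nrm Z * K + K * nrm Z)) => m.
have -> : mm Z Y - mm Y Z = - mm Z (u m - Y) + mm (u m - Y) Z.
  by rewrite mmBl mmBr uZ opprB addrA subrK.
apply: le_trans (nrmD _ _) _; rewrite nrmN mulrDl; apply: lerD.
  by apply: le_trans (nrmM _ _) _; rewrite -mulrA ler_wpM2l ?nrm_ge0.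
apply: le_trans (nrmM _ _) _; rewrite [leRHS]mulrAC.
by rewrite ler_wpM2r ?nrm_ge0.
Qed.

End Matrices.
End CStarAlgebra.

(** * Unitary dilations and approximate units *)

Section ApproximateUnit.
Variables (R : realType) (A : cstarAlgType R).
Local Notation C := R[i].
Local Infix "**" := (@amul R A) (at level 40, left associativity).
Implicit Types a b c e x y z : A.

Lemma sqrtA_one_sub b : star b = b -> nm b < 1 ->
  exists c, [/\ star c = c, b = c + c - c ** c &
    forall z, z ** b = b ** z -> z ** c = c ** z].
Proof.
move=> bs b1; pose sc x : 'M[A]_1 := \matrix_(i, j) x.
have scM x y : mm (sc x) (sc y) = sc (x ** y).
  by apply/matrixP => i j; rewrite !mxE big_ord1 !mxE.
have scE (X : 'M[A]_1) : X = sc (X 0 0).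
  by apply/matrixP => i j; rewrite !mxE !ord1.
have sci x y : sc x = sc y -> x = y.
  by move/matrixP/(_ 0 0); rewrite !mxE.
have b0 := nm_ge0 b.
(* The 1 x 1 case. For this radius [r], [2 r - r^2 = 1 - ((1 - nm b) / 2)^2], which is at least
   [nm b]. *)
have [||||Y [Ys BY Yc]] := @sqrt_one_sub R A 1 (sc b) ((1 + nm b) / 2).
- by lra.
- by lra.
- by apply/matrixP => i j; rewrite !mxE.
- by rewrite /nrm !big_ord1 mxE; have := sqr_ge0 (1 - nm b); nra.
have {}scE := scE Y; exists (Y 0 0); split.
- by move/matrixP: Ys => /(_ 0 0); rewrite mxE.
- by move/matrixP: BY => /(_ 0 0); rewrite !mxE big_ord1.
move=> z zb; apply: sci; rewrite -!scM -scE; apply: Yc.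
by rewrite !scM zb.
Qed.

Lemma starZR (r : R) x : star (r%:C *: x) = r%:C *: star x.
Proof.
by rewrite starZ; congr (_ *: _); apply/eqP; rewrite eq_complex /= oppr0 !eqxx.
Qed.

Lemma nmMn (V : normedModType C) (v : V) n : nm (v *+ n) = n%:R * nm v.
Proof. by rewrite -scaler_nat -(rmorph_nat (real_complex R)) nmZR // ler0n. Qed.

Lemma mulrn2Z x : x *+ 2 = 2 *: x. Proof. by rewrite scaler_nat. Qed.
Lemma mulrn3Z x : x *+ 3 = 3 *: x. Proof. by rewrite scaler_nat. Qed.
Lemma mulrn4Z x : x *+ 4 = 4 *: x. Proof. by rewrite scaler_nat. Qed.
Definition mulrnZ := (mulrn2Z, mulrn3Z, mulrn4Z).

Lemma sqr_le_eq (s t : R) : 0 <= s -> 0 <= t -> s ^+ 2 <= t * s -> s <= t.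
Proof.
move=> s0 t0; have [->//|sn] := eqVneq s 0.
by rewrite expr2 ler_pM2r // lt_neqAle eq_sym sn.
Qed.

(* [u = x + i (1 - x^2)^(1/2)], acting on [A] by left multiplication. *)
Lemma unitary_dilation x : star x = x -> nm x < 1 ->
  exists u u' : A -> A, [/\ linear u, linear u',
    (forall y, u' (u y) = y) /\ (forall y, u (u' y) = y),
    (forall y, nm (u y) = nm y) /\ (forall y, nm (u' y) = nm y) &
    forall y, u y + u' y = x ** y + x ** y].
Proof.
move=> xs x1.
have [||c [cs cE cx]] := @sqrtA_one_sub (x ** x).
- by rewrite starM xs.
- by have := nmM x x; have := nm_ge0 x; nra.
have {}cx : x ** c = c ** x by apply: cx; rewrite amulA.
(* Left multiplication by [1 - c], that is, by [(1 - x^2)^(1/2)]; then [w k] is [x + k s], to be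
   used for [k = i] and [k = -i]. *)
pose s y := y - c ** y.
have sZ (k : C) y : s (k *: y) = k *: s y by rewrite /s amulZr scalerBr.
have sD y z : s (y + z) = s y + s z by rewrite /s amulDr; lcomb C.
have sx y : x ** s y = s (x ** y) by rewrite /s amulBr !amulA cx.
have ss y : s (s y) = y - x ** x ** y.
  rewrite /s cE amulBr amulBl amulDl amulA; lcomb C.
pose w (k : C) y := x ** y + k *: s y.
have wl k : linear (w k).
  by move=> l y z; rewrite /w amulDr amulZr sD sZ; lcomb C.
have wN (k : C) y : k ^+ 2 = -1 -> w (- k) (w k y) = y.
  move=> k2; rewrite /w amulDr amulZr sD sZ sx ss amulA.
  set p := s _; set q := y - _.
  have -> : (- k) *: (p + k *: q) = - (k *: p) + q.
    by rewrite scalerDr scalerA mulNr -expr2 k2 opprK scale1r scaleNr.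
  by rewrite /q; lcomb C.
have wst (k : C) y z : star (w k y) ** z = star y ** w (Num.conj k) z.
  rewrite /w /s starD starZ starB !starM xs cs amulDr amulZr amulBr.
  by rewrite amulDl amulZl amulBl !amulA.
have ci : Num.conj ('i%C : C) = - 'i%C by apply/eqP; rewrite eq_complex /= oppr0 !eqxx.
(* By [wst] the adjoint of [w k] is [w (- k)], its inverse, so the C*-identity makes [w k]
   isometric. *)
have wn (k : C) y : k ^+ 2 = -1 -> Num.conj k = - k -> nm (w k y) = nm y.
  move=> k2 kc; apply/eqP; rewrite -(@eqrXn2 _ 2) ?nm_ge0 //.
  by rewrite -!nm_starM wst kc wN.
have i2 : ('i%C : C) ^+ 2 = -1 := sqr_i R.
exists (w 'i%C), (w (- 'i%C)); split=> //.
- by split=> y; [apply: wN|rewrite -{1}['i%C]opprK wN // sqrrN].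
- by split=> y; apply: wn; rewrite ?sqrrN // rmorphN /= ci.
by move=> y; rewrite /w scaleNr; lcomb C.
Qed.

Lemma linear_add (f : A -> A) : linear f -> forall y z, f (y + z) = f y + f z.
Proof. by move=> fl y z; have := fl 1 y z; rewrite !scale1r. Qed.

(** Since [2 x = u + u^-1], [4 (1 - x^2) = 2 - u^2 - u^-2], of norm at most 4. *)
Lemma nm_one_sub_sqr x y : star x = x -> nm x < 1 ->
  nm (y - x ** (x ** y)) <= nm y.
Proof.
move=> xs x1.
have [u [u' [/linear_add uD /linear_add uD' [u'u uu'] [un un'] h]]] :=
  unitary_dilation xs x1.
have e : (y - x ** (x ** y)) *+ 4 = y + y - u (u y) - u' (u' y).
  have := h (x ** y + x ** y); rewrite -h uD uD' u'u uu' h amulDr => e.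
  have -> : u (u y) = x ** (x ** y) + x ** (x ** y) +
     (x ** (x ** y) + x ** (x ** y)) - y - (y + u' (u' y)).
    by rewrite -e; lcomb C.
  by rewrite mulrnZ; lcomb C.
have : nm ((y - x ** (x ** y)) *+ 4) = 4 * nm (y - x ** (x ** y)).
  exact: nmMn.
rewrite e; have := nmD (y + y - u (u y)) (- u' (u' y)).
have := nmD (y + y) (- u (u y)); have := nmD y y; rewrite !nmN !un !un'; lra.
Qed.

(* The Chebyshev polynomial [4 t^3 - 3 t] is [cos (3 arccos t)]. *)
Lemma nm_chebyshev3 x y : star x = x -> nm x < 1 ->
  nm (x ** (x ** (x ** y)) *+ 4 - (x ** y) *+ 3) <= nm y.
Proof.
move=> xs x1.
have [u [u' [/linear_add uD /linear_add uD' [u'u uu'] [un un'] h]]] :=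
  unitary_dilation xs x1.
(* [u^n + u^-n] is twice the Chebyshev polynomial [T_n(x)]: here for [n = 2], below for [n = 3]. *)
have h2 z : u (u z) + u' (u' z) = (x ** (x ** z)) *+ 4 - z - z.
  have := h (x ** z + x ** z); rewrite -{1 2}h uD uD' u'u uu' amulDr => e.
  have -> : u (u z) = u (u z) + z + (z + u' (u' z)) - z - (z + u' (u' z)).
    by lcomb C.
  by rewrite e -scaler_nat; lcomb C.
have e : (x ** (x ** (x ** y)) *+ 4 - (x ** y) *+ 3) *+ 2 =
    u (u (u y)) + u' (u' (u' y)).
  have := h2 (x ** y + x ** y); rewrite -{1 2}h !uD !uD' u'u uu' !amulDr => e.
  have e' : u (u (u y)) = u (u (u y)) + u y + (u' y + u' (u' (u' y)))
      - (u y + u' y) - u' (u' (u' y)) by lcomb C.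
  by rewrite e' e h !mulrnZ; lcomb C.
have : nm ((x ** (x ** (x ** y)) *+ 4 - (x ** y) *+ 3) *+ 2) =
    2 * nm (x ** (x ** (x ** y)) *+ 4 - (x ** y) *+ 3).
  exact: nmMn.
by rewrite e; have := nmD (u (u (u y))) (u' (u' (u' y))); rewrite !un !un'; lra.
Qed.

(* [1 - e], in the unitization, is a contraction. *)
Definition contr e := forall y, nm (y - e ** y) <= nm y.

(** Applied to [star e], the hypothesis bounds [|e|^2 = |e e^*|] by [2 |e^*|]. *)
Lemma contr_nm e : contr e -> nm e <= 2.
Proof.
move=> ce; apply: sqr_le_eq; rewrite ?nm_ge0 // -nm_Mstar.
have := nmD (star e) (- (star e - e ** star e)).
by rewrite nmN opprB addrC subrK; have := ce (star e); rewrite nm_star; lra.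
Qed.

(** [1 - (f + e - f e) = (1 - f) (1 - e)]. *)
Lemma contr_comp e f : contr e -> contr f -> contr (f + e - f ** e) /\
  forall y, y - (f + e - f ** e) ** y = (y - e ** y) - f ** (y - e ** y).
Proof.
move=> ce cf.
have h y : y - (f + e - f ** e) ** y = (y - e ** y) - f ** (y - e ** y).
  by rewrite amulBr amulBl amulDl amulA; lcomb C.
by split=> // y; rewrite h (le_trans (cf _)).
Qed.

Lemma contr_star e : contr e -> contr (star e).
Proof.
move=> ce y; apply: sqr_le_eq; rewrite ?nm_ge0 // -nm_starM.
set z := y - _.
have -> : star z ** z = star y ** (z - e ** z).
  by rewrite {1}/z starB starM starK amulBl amulBr amulA.
by apply: le_trans (nmM _ _) _; rewrite nm_star ler_wpM2l ?nm_ge0.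
Qed.

(** By the C*-identity the left side is the norm of [(1 - e) a a^* (1 - e)^*], where one of the
    outer factors is absorbed as a contraction. This reduces the approximation of [a] to that of
    [a a^*]. *)
Lemma contr_sqr e a : contr e ->
  nm (a - e ** a) ^+ 2 <= nm (a ** star a - e ** (a ** star a)).
Proof.
move=> ce; rewrite -nm_Mstar; set z := a ** star a - _.
have -> : (a - e ** a) ** star (a - e ** a) = star (star z - e ** star z).
  rewrite [RHS]starB [in RHS]starM !starK /z starB starM amulBr !amulBl !amulA.
  by lcomb C.
by rewrite nm_star -[leRHS]nm_star; apply: ce.
Qed.

(** With [b = x^2], [f j = 1 - (1 - b)^j], and [e] is the mean of [f 0, ..., f N]. As
    [b - f_j b = f_(j+1) - f_j], the sum telescopes to [b - e b = f_(N+1) / (N+1)], of norm at most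
    [2 / (N+1)]. *)
Lemma contr_approx_sqr x (d : R) : star x = x -> nm x < 1 -> 0 < d ->
  exists2 e, contr e & nm (x ** x - e ** (x ** x)) <= d.
Proof.
move=> xs x1 d0; set b := x ** x.
pose f j := iter j (fun e => e + b - e ** b) 0.
have fc j : contr (f j).
  elim: j => [|j IH] y; first by rewrite /= amul0l subr0.
  have -> : y - f j.+1 ** y = (y - b ** y) - f j ** (y - b ** y).
    by rewrite /= -/(f j) amulBr amulBl amulDl amulA; lcomb C.
  apply: le_trans (IH _) _.
  by rewrite /b -amulA; apply: nm_one_sub_sqr.
have [N hN] := archi_inv (divr_gt0 d0 (ltr0Sn R 1)).
pose k : R := N.+1%:R; have k0 : 0 < k by rewrite ltr0Sn.
have kV y : k^-1%:C *: \sum_(j < N.+1) y = y.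
  rewrite sumr_const card_ord -scaler_nat scalerA -[N.+1%:R](rmorph_nat (real_complex R)).
  by rewrite -rmorphM mulVf ?gt_eqF // scale1r.
exists (k^-1%:C *: \sum_(j < N.+1) f j).
  move=> y; rewrite -{1}(kV y) amulZl amul_suml -scalerBr -sumrB.
  rewrite nmZR ?invr_ge0 ?(ltW k0) //.
  rewrite ler_pdivrMl // (le_trans (nm_sum _ _ _)) //.
  apply: (@le_trans _ _ (\sum_(j < N.+1) nm y)).
    by apply: ler_sum => j _; apply: fc.
  by rewrite sumr_const card_ord -mulr_natl.
rewrite -{1}(kV b) amulZl amul_suml -scalerBr -sumrB nmZR ?invr_ge0 ?(ltW k0) //.
have -> : \sum_(j < N.+1) (b - f j ** b) = f N.+1.
  elim: N.+1 => [|m IH]; first by rewrite big_ord0.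
  by rewrite big_ord_recr /= IH -/(f m) addrA.
have := hN N (leqnn N); rewrite -/k ler_pdivlMr //; apply: le_trans.
by apply: ler_wpM2l; rewrite ?invr_ge0 ?(ltW k0) ?contr_nm.
Qed.

(** For [p = a a^*], [contr_sqr] used twice gives [|a - e a|^4 <= |p - e p|^2 <= |p^2 - e p^2|]. The
    factor [s] brings [p] into the open unit ball, whence the precision [s^2 d^4]. *)
Lemma contr_approx1 a (d : R) : 0 < d -> exists2 e, contr e & nm (a - e ** a) <= d.
Proof.
move=> d0; pose p := a ** star a.
have ps : star p = p by rewrite starM starK.
pose s : R := (nm p + 1)^-1.
have p0 := nm_ge0 p.
have s0 : 0 < s by rewrite invr_gt0; lra.
pose x := s%:C *: p.
have xs : star x = x by rewrite starZR ps.
have x1 : nm x < 1.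
  by rewrite nmZR ?(ltW s0) // /s ltr_pdivrMl; lra.
have [e ce he] := contr_approx_sqr xs x1 (mulr_gt0 (exprn_gt0 2 s0) (exprn_gt0 4 d0)).
exists e => //.
have : s ^+ 2 * nm (p ** p - e ** (p ** p)) <= s ^+ 2 * d ^+ 4.
  apply: le_trans he; rewrite /x amulZl amulZr !scalerA amulZr -scalerBr.
  by rewrite -rmorphM nmZR ?mulr_ge0 ?(ltW s0).
rewrite ler_pM2l ?exprn_gt0 // => h.
have h1 := contr_sqr p ce; rewrite ps in h1.
have h2 := contr_sqr a ce; rewrite -/p in h2.
rewrite -(@ler_pXn2r _ 4) ?nnegrE ?nm_ge0 ?(ltW d0) //.
apply: le_trans h; apply: le_trans h1.
by rewrite (exprM _ 2 2) ler_pXn2r ?nnegrE ?nm_ge0 ?sqr_ge0.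
Qed.

(** Induction on the list: [f] treats the remainder [(1 - e) a] of the new element, and the
    contraction [1 - f] does not enlarge the earlier remainders. *)
Lemma contr_approx (s : seq A) (d : R) : 0 < d ->
  exists2 e, contr e & forall a, a \in s -> nm (a - e ** a) <= d.
Proof.
move=> d0; elim: s => [|a s [e ce he]].
  by exists 0 => // y; rewrite amul0l subr0.
have [f cf hf] := contr_approx1 (a - e ** a) d0.
have [cfe hfe] := contr_comp ce cf.
exists (f + e - f ** e) => // b; rewrite inE hfe => /predU1P[->//|/he].
by apply: le_trans; apply: cf.
Qed.

Lemma selfadj_approx (s : seq A) (d : R) : 0 < d ->
  exists e, [/\ star e = e, nm e < 2 & forall a, a \in s -> nm (a - e ** a) <= d].
Proof.
move=> d0; pose L : R := \sum_(a <- s) nm a.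
have L0 : 0 <= L by apply: sumr_ge0 => a _; apply: nm_ge0.
have aL a : a \in s -> nm a <= L.
  by move=> sa; rewrite /L (big_rem a) //= lerDl; apply: sumr_ge0 => b _; apply: nm_ge0.
pose d1 := d / 2; have d10 : 0 < d1 by rewrite divr_gt0.
have [e ce he] := contr_approx s d10.
have [cf hf] := contr_comp ce (contr_star ce).
set f := star e + e - star e ** e in cf hf.
(* [1 - t = d1 / (d1 + L + 1)]: scaling by [t < 1] makes the norm strictly less than 2 and adds an
   error of at most [d1]. *)
pose t : R := (L + 1) / (d1 + L + 1).
have D0 : 0 < d1 + L + 1 by lra.
have t0 : 0 < t by rewrite divr_gt0 //; lra.
have t1 : t < 1 by rewrite ltr_pdivrMr //; lra.
have tL : (1 - t) * L <= d1.
  have : t * (d1 + L + 1) = L + 1 by rewrite divfK // gt_eqF.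
  nra.
exists (t%:C *: f); split.
- by rewrite starZR /f starB starD starM !starK [e + _]addrC.
- rewrite nmZR ?(ltW t0) //; have := contr_nm cf; have := nm_ge0 f; nra.
move=> a sa; have -> : a - (t%:C *: f) ** a = t%:C *: (a - f ** a) + (1 - t)%:C *: a.
  by rewrite amulZl rmorphB rmorph1 scalerBr scalerBl scale1r; lcomb C.
apply: le_trans (nmD _ _) _; rewrite !nmZR ?subr_ge0 ?(ltW t0) ?(ltW t1) //.
have : nm (a - f ** a) <= d1 by rewrite hf (le_trans (contr_star ce _)) ?he.
have := aL a sa; have := nm_ge0 (a - f ** a); have : 0 <= 1 - t by lra.
rewrite /d1 in tL *; nra.
Qed.

(** With [x = f / 2], take [e = 3 x - 4 x^3 = - T_3(x)]: the Chebyshev bound gives [|e| <= 1], and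
    [- T_3(1/2) = 1], so [e] acts almost as 1 where [f] does. *)
Lemma approx_unit (s : seq A) (d : R) : 0 < d ->
  exists2 e, nm e <= 1 & forall a, a \in s -> nm (a - e ** a) <= d.
Proof.
move=> d0; have [f [fs f2 hf]] := selfadj_approx s (divr_gt0 d0 (ltr0Sn R 3)).
pose x := 2^-1 *: f.
have xs : star x = x by rewrite starZ conj_half fs.
have x1 : nm x < 1 by rewrite nmZ_half; lra.
have fx y : f ** y = x ** y + x ** y by rewrite /x amulZl; lcomb C.
clearbody x; pose e := x *+ 3 - (x ** (x ** x)) *+ 4.
have eE y : e ** y = - (x ** (x ** (x ** y)) *+ 4 - (x ** y) *+ 3).
  by rewrite /e amulBl !mulrnZ !amulZl -!amulA; lcomb C.
exists e.
  apply: sqr_le_eq; rewrite ?nm_ge0 // -nm_Mstar eE nmN mul1r -[leRHS]nm_star.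
  exact: nm_chebyshev3.
move=> a sa; set z := a - f ** a.
(* [1 - e = (1 - f/2 - f^2/2) (1 - f)], whose first factor has norm at most [1 + 1 + 2]; hence the
   precision [d / 4] for [f]. *)
have ea : a - e ** a = z - (2^-1 *: (f ** z) + 2^-1 *: (f ** (f ** z))).
  by rewrite eE /z !fx !mulrnZ !(amulDr, amulNr); lcomb C.
rewrite ea; apply: le_trans (nmD _ _) _; rewrite nmN.
have := nmD (2^-1 *: (f ** z)) (2^-1 *: (f ** (f ** z))); rewrite !nmZ_half.
have := hf a sa; rewrite -/z; have := nmM f z; have := nmM f (f ** z).
have := nm_ge0 z; have := nm_ge0 f; have := nm_ge0 (f ** z); nra.
Qed.

End ApproximateUnit.

(** The sequence [x m / q^m] is convex and bounded above, hence nonincreasing; [D] is [q] times its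
    first increment. *)
Lemma convex_growth (R : realType) (x : nat -> R) (q K : R) : 0 < q ->
  (forall m, 2 * q * x m.+1 <= q ^+ 2 * x m + x m.+2) ->
  (forall m, x m <= K * q ^+ m) -> x 1%N <= q * x 0%N.
Proof.
move=> q0 cx xK; pose D := x 1%N - q * x 0%N.
have qm m : 0 < q ^+ m by rewrite exprn_gt0.
have h1 m : D * q ^+ m <= x m.+1 - q * x m.
  elim: m => [|m IH]; first by rewrite expr0 mulr1.
  by have := cx m; have := ler_wpM2l (ltW q0) IH; rewrite [q ^+ m.+1]exprS; lra.
have h2 m : (q * x 0%N + m%:R * D) * q ^+ m <= q * x m.
  elim: m => [|m IH]; first by rewrite mul0r addr0 expr0 mulr1.
  have := ler_wpM2l (ltW q0) (h1 m); have := ler_wpM2l (ltW q0) IH.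
  by rewrite -natr1 [q ^+ m.+1]exprS; lra.
rewrite -subr_le0 -/D leNgt; apply/negP => D0.
have h3 m : m%:R * D <= q * (K - x 0%N).
  have := le_trans (h2 m) (ler_wpM2l (ltW q0) (xK m)).
  by rewrite mulrA ler_pM2r //; lra.
pose E := `|q * (K - x 0%N)| + 1; have E0 : 0 < E by rewrite ltr_wpDl.
have [N hN] := archi_inv (divr_gt0 D0 E0).
have := h3 N.+1; have := hN N (leqnn N); rewrite ler_pdivlMr // ler_pdivrMl ?ltr0Sn //.
by have := ler_norm (q * (K - x 0%N)); rewrite /E; lra.
Qed.

(** * Complete contractivity of representations *)

Section OpLinear.
Variables (R : realType) (E V W : normedModType R[i]) (T : E -> bop V W).
Hypothesis TL : op_linear T.

Lemma opD x y v : T (x + y) v = T x v + T y v.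
Proof. by have := TL 1 x y v; rewrite !scale1r. Qed.
Lemma op0 v : T 0 v = 0.
Proof. by apply: (addrI (T 0 v)); rewrite -opD !addr0. Qed.
Lemma opZ c x v : T (c *: x) v = c *: T x v.
Proof. by have := TL c x 0 v; rewrite op0 !addr0. Qed.
Lemma opN x v : T (- x) v = - T x v.
Proof. by rewrite -scaleN1r opZ scaleN1r. Qed.
Lemma opB x y v : T (x - y) v = T x v - T y v.
Proof. by rewrite opD opN. Qed.
Lemma op_sum I (s : seq I) (P : pred I) (F : I -> E) v :
  T (\sum_(i <- s | P i) F i) v = \sum_(i <- s | P i) T (F i) v.
Proof. by apply: (big_morph (fun x => T x v) (fun x y => opD x y v) (op0 v)). Qed.
End OpLinear.

Section Representation.
Variables (R : realType) (A : cstarAlgType R) (H : hilbertType R).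
Variable sigma : A -> bop H H.
Hypothesis sigmaP : star_rep sigma.
Local Notation C := R[i].
Local Infix "**" := (@amul R A) (at level 40, left associativity).

Lemma sigL : op_linear sigma.
Proof. by case: sigmaP. Qed.
Lemma sigM a b v : sigma (a ** b) v = sigma a (sigma b v).
Proof. by case: sigmaP => _ h _; apply: h. Qed.
Lemma sig_adj a x y : hdot (sigma a x) y = hdot x (sigma (star a) y).
Proof. by case: sigmaP => _ _; apply. Qed.
Let sigD := opD sigL.
Let sig0 := op0 sigL.
Let sigZ := opZ sigL.
Let sigN := opN sigL.
Let sigB := opB sigL.
Let sig_sum := op_sum sigL.

(** Writing [a^* a = 2 c - c^2] gives [|h|^2 - |sigma(a) h|^2 = |h - sigma(c) h|^2]. *)
Lemma sig_contractive_lt1 a h : nm a < 1 -> nm (sigma a h) <= nm h.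
Proof.
move=> a1; have [||c [cs cE _]] := @sqrtA_one_sub R A (star a ** a).
- by rewrite starM starK.
- by rewrite nm_starM; have := nm_ge0 a; nra.
rewrite -(@ler_pXn2r _ 2) ?nnegrE ?nm_ge0 //.
have : 0 <= nm (h - sigma c h) ^+ 2 by exact: sqr_ge0.
rewrite nmB_sqr -!rdotxx /rdot !sig_adj cs -!sigM cE !(sigD, sigN).
by rewrite !(hdotDr, hdotNr) !(raddfD, raddfN); lra.
Qed.

(** The factor 2 comes from rescaling [a] to norm 1/2; the constant in [slow] absorbs it. *)
Lemma sig_bounded a h : nm (sigma a h) <= 2 * nm a * nm h.
Proof.
have [/nm0_eq0 ->|a0] := eqVneq (nm a) 0.
  by rewrite sig0 !nm0 mulr0 mul0r.
have p : 0 < nm a by rewrite lt_neqAle eq_sym a0 nm_ge0.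
have q : 0 < 2 * nm a by lra.
have q' : 0 <= (2 * nm a)^-1 by rewrite invr_ge0 ltW.
have : nm ((2 * nm a)^-1%:C *: a) < 1.
  by rewrite nmZR // ltr_pdivrMl //; lra.
by move=> /(@sig_contractive_lt1 _ h); rewrite sigZ nmZR // ler_pdivrMl.
Qed.

Section Amplification.
Variable n : nat.
Local Notation An := ('I_n -> A).
Local Notation Hn := ('I_n -> H).
Implicit Types (X Y : 'M[A]_n) (d : An) (k : Hn) (h : H).

(* For a matrix [X] over [A]: [va] is its action on [A^n], [ip] the inner product
   of the Hilbert module [A^n], and [ha] the action of [sigma X] on [H^n]. *)
Definition va X d : An := fun i => \sum_j X i j ** d j.
Definition ip d d' : A := \sum_i star (d i) ** d' i.
Definition ha X k : Hn := fun i => \sum_j sigma (X i j) (k j).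
Definition hip k k' : R := \sum_i rdot (k i) (k' i).
Definition hn2 k : R := \sum_i nm (k i) ^+ 2.

Lemma va_mm X Y d i : va X (va Y d) i = va (mm X Y) d i.
Proof.
rewrite /va; under eq_bigr do rewrite amul_sumr.
under [RHS]eq_bigr do rewrite mxE amul_suml.
by rewrite exchange_big; do 2!apply: eq_bigr => ? _; rewrite amulA.
Qed.
Lemma va_adj X d d' : ip (va X d) d' = ip d (va (mstar X) d').
Proof.
rewrite /ip /va; under eq_bigr do rewrite star_sum amul_suml.
under [RHS]eq_bigr do rewrite amul_sumr.
by rewrite exchange_big; do 2!apply: eq_bigr => ? _; rewrite starM mxE amulA.
Qed.
Lemma ha_mm X Y k i : ha X (ha Y k) i = ha (mm X Y) k i.
Proof.
rewrite /ha; under eq_bigr do rewrite bop_sum.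
under [RHS]eq_bigr do rewrite mxE sig_sum.
by rewrite exchange_big; do 2!apply: eq_bigr => ? _; rewrite sigM.
Qed.
Lemma ha_adj X k k' : hip (ha X k) k' = hip k (ha (mstar X) k').
Proof.
rewrite /hip /ha /rdot -!raddf_sum; congr (Re _).
under eq_bigr do rewrite hdot_suml.
under [RHS]eq_bigr do rewrite hdot_sumr.
by rewrite exchange_big; do 2!apply: eq_bigr => ? _; rewrite mxE sig_adj.
Qed.
Lemma hipxx k : hip k k = hn2 k.
Proof. by apply: eq_bigr => i _; rewrite rdotxx. Qed.
Lemma hn2D k k' : hn2 (k + k') <= 2 * hn2 k + 2 * hn2 k'.
Proof.
rewrite /hn2 !mulr_sumr -big_split; apply: ler_sum => i _ /=.
rewrite -[(k + k') i]/(k i + k' i) nmD_sqr.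
by have := sqr_ge0 (nm (k i - k' i)); rewrite nmB_sqr; lra.
Qed.

Variable Y : 'M[A]_n.
Hypothesis Ys : mstar Y = Y.
Definition sv d : An := d - va Y d.
Definition sh k : Hn := k - ha Y k.

Lemma sh_adj k k' : hip (sh k) k' = hip k (sh k').
Proof.
have e1 : hip (sh k) k' = hip k k' - hip (ha Y k) k'.
  by rewrite /hip -sumrB; apply: eq_bigr => i _; rewrite -rdotBl.
have e2 : hip k (sh k') = hip k k' - hip k (ha Y k').
  by rewrite /hip -sumrB; apply: eq_bigr => i _; rewrite -rdotBr.
by rewrite e1 e2 ha_adj Ys.
Qed.

Lemma shD k k' : sh (k + k') = sh k + sh k'.
Proof.
apply/funext => i; rewrite /sh /ha !fctE -[RHS]addrACA -opprD -big_split /=.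
by congr (_ - _); apply: eq_bigr => j _; rewrite bopD.
Qed.

(** Self-adjointness of [s = sh] gives [|s^(m+1) k|^2 = <s^m k, s^(m+2) k>]; then expand
    [|q s^m k - s^(m+2) k|^2 >= 0]. *)
Lemma sh_convex k (q : R) m :
  2 * q * hn2 (iter m.+1 sh k) <=
    q ^+ 2 * hn2 (iter m sh k) + hn2 (iter m.+2 sh k).
Proof.
have -> : hn2 (iter m.+1 sh k) = hip (iter m sh k) (iter m.+2 sh k).
  by rewrite -hipxx /= sh_adj.
rewrite -subr_ge0 /hip /hn2 !mulr_sumr -big_split -sumrB.
apply: sumr_ge0 => i _ /=; set x := iter m sh k i; set y := sh _ _.
have := sqr_ge0 (nm (q%:C *: x - y)).
by rewrite nmB_sqr -!rdotxx !rdotZr ![rdot (_ *: _) _]rdotC !rdotZr (rdotC y x); lra.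
Qed.

(* Unlike the bound [|sh k|^2 <= q |k|^2] that it implies, [slow] is closed under
   sums, so that it suffices to check it on cyclic vectors. *)
Definition slow (q : R) k := exists K, forall m, hn2 (iter m sh k) <= K * q ^+ m.

Lemma slowD q k k' : slow q k -> slow q k' -> slow q (k + k').
Proof.
move=> [K hK] [K' hK']; exists (2 * K + 2 * K') => m.
have -> : iter m sh (k + k') = iter m sh k + iter m sh k'.
  by elim: m => //= m ->; rewrite shD.
by apply: le_trans (hn2D _ _) _; have := hK m; have := hK' m; lra.
Qed.

Lemma slow0 q : slow q 0.
Proof.
exists 0 => m; rewrite mul0r.
have -> : iter m sh 0 = 0.
  elim: m => //= m ->; apply/funext => i.
  by rewrite /sh /ha !fctE big1 ?subrr // => j _; rewrite bop0.
by rewrite /hn2 big1 // => i _; rewrite [X in nm X]/(0) nm0 expr0n.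
Qed.

Lemma sh_sv d h : sh (fun i => sigma (d i) h) = fun i => sigma (sv d i) h.
Proof.
apply/funext => i; rewrite /sh /sv /ha /va !fctE sigB sig_sum.
by congr (_ - _); apply: eq_bigr => j _; rewrite sigM.
Qed.

(** On a cyclic vector [s^m] acts through [A^n]: the square norm is [<h, sigma(<s^m d, s^m d>) h>],
    and the hypothesis is iterated in the Hilbert module. *)
Lemma slow_cyclic (q : R) d h :
  (forall d, nm (ip (sv d) (sv d)) <= q * nm (ip d d)) -> 0 <= q ->
  slow q (fun i => sigma (d i) h).
Proof.
move=> hq q0; exists (2 * nm (ip d d) * nm h ^+ 2) => m.
have -> : iter m sh (fun i => sigma (d i) h) = fun i => sigma (iter m sv d i) h.
  by elim: m => //= m ->; rewrite sh_sv.
set e := iter m sv d.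
have he : nm (ip e e) <= q ^+ m * nm (ip d d).
  rewrite /e; elim: m {e} => [|m IH]; first by rewrite expr0 mul1r.
  by apply: le_trans (hq _) _; rewrite exprS -mulrA ler_wpM2l.
have -> : hn2 (fun i => sigma (e i) h) = rdot h (sigma (ip e e) h).
  rewrite /ip sig_sum /rdot hdot_sumr raddf_sum; apply: eq_bigr => i _.
  by rewrite -rdotxx /rdot sig_adj sigM.
apply: le_trans (rdot_le _ _) _.
have := ler_wpM2l (nm_ge0 h) (sig_bounded (ip e e) h).
have := ler_wpM2l (sqr_ge0 (nm h)) he; lra.
Qed.

End Amplification.
End Representation.

Section CompleteContractivity.
Variables (R : realType) (A : cstarAlgType R) (H : hilbertType R).
Variable sigma : A -> bop H H.
Hypotheses (sigmaP : star_rep sigma) (sigma_nd : nondegenerate_rep sigma).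
Local Notation C := R[i].
Local Infix "**" := (@amul R A) (at level 40, left associativity).
Local Notation D := (lspan [set v | exists a h, v = sigma a h]).
Variable n : nat.
Implicit Types (X Y : 'M[A]_n) (d : 'I_n -> A) (k : 'I_n -> H) (h : H).
Local Notation ha := (ha sigma).

Lemma ha_sub X k k' i : ha X (k - k') i = ha X k i - ha X k' i.
Proof. by rewrite /ha -sumrB; apply: eq_bigr => j _; rewrite !fctE bopB. Qed.

Lemma ha_bounded X k i (e : R) : 0 <= e -> (forall j, nm (k j) <= e) ->
  nm (ha X k i) <= 2 * nrm X * e.
Proof.
move=> e0 ke; apply: le_trans (nm_sum _ _ _) _.
apply: (@le_trans _ _ (\sum_j 2 * nm (X i j) * e)).
  apply: ler_sum => j _; apply: le_trans (sig_bounded sigmaP _ _) _.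
  by apply: ler_wpM2l => //; rewrite mulr_ge0 ?nm_ge0.
rewrite -mulr_suml -mulr_sumr; apply: ler_wpM2r => //; apply: ler_wpM2l => //.
rewrite /nrm [leRHS](bigD1 i) //= lerDl.
by do 2!apply: sumr_ge0 => ? _; apply: nm_ge0.
Qed.

Lemma hn2_le_dense X (r : R) :
  (forall k, (forall j, D (k j)) -> hn2 (ha X k) <= r ^+ 2 * hn2 k) ->
  forall k, hn2 (ha X k) <= r ^+ 2 * hn2 k.
Proof.
move=> hD k.
pose L1 : R := \sum_j (2 * nm (k j) + 1).
pose L2 : R := 2 * nrm X.
pose L3 : R := \sum_i L2 * (2 * nm (ha X k i) + L2).
have L20 : 0 <= L2 by rewrite mulr_ge0 ?nrm_ge0.
have L10 : 0 <= L1.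
  by apply: sumr_ge0 => j _; have := nm_ge0 (k j); lra.
have L30 : 0 <= L3.
  apply: sumr_ge0 => i _; have := nm_ge0 (ha X k i) => ?.
  by rewrite mulr_ge0 // addr_ge0 // mulr_ge0.
(* Moving each [k j] by less than [e] changes [hn2 k] by at most [e * L1] and [hn2 (ha X k)] by at
   most [e * L3], in the directions used. *)
suff main e : 0 < e -> e <= 1 ->
    hn2 (ha X k) <= r ^+ 2 * hn2 k + e * (r ^+ 2 * L1 + L3).
  apply/ler_addgt0Pr => e e0; set L := r ^+ 2 * L1 + L3 in main.
  have L0 : 0 <= L by rewrite addr_ge0 // mulr_ge0 // sqr_ge0.
  have d0 : 0 < e + L + 1 by lra.
  have c0 : 0 < e / (e + L + 1) by rewrite divr_gt0.
  have c1 : e / (e + L + 1) <= 1 by rewrite ler_pdivrMr //; lra.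
  have cE : e / (e + L + 1) * (e + L + 1) = e by rewrite divfK // gt_eqF.
  by have := main _ c0 c1; nra.
move=> e0 e1.
have /choice [k' hk'] : forall j, exists v, D v /\ nm (k j - v) < e.
  by move=> j; have [v] := dense_nm sigma_nd (k j) e0; exists v.
have n1 : hn2 k' <= hn2 k + e * L1.
  rewrite /hn2 /L1 mulr_sumr -big_split; apply: ler_sum => j _ /=.
  have := nmD (k' j - k j) (k j); rewrite subrK nmB; have := (hk' j).2.
  by have := nm_ge0 (k j); have := nm_ge0 (k' j); nra.
have n2 : hn2 (ha X k) <= hn2 (ha X k') + e * L3.
  rewrite /hn2 /L3 mulr_sumr -big_split; apply: ler_sum => i _ /=.
  have : nm (ha X k i - ha X k' i) <= L2 * e.
    rewrite -ha_sub; apply: ha_bounded; first exact: ltW.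
    by move=> j; apply/ltW; case: (hk' j).
  have := nmD (ha X k' i - ha X k i) (ha X k i).
  have := nmD (ha X k i - ha X k' i) (ha X k' i).
  rewrite !subrK [nm (ha X k' i - _)]nmB.
  have := nm_ge0 (ha X k i); have := nm_ge0 (ha X k' i).
  move: (nm (ha X k i)) (nm (ha X k' i)) (nm (_ - _)) => p q s q0 p0 h1 h2 h3.
  have h4 : q <= p + L2 by have := ler_wpM2l L20 e1; lra.
  have h5 : p ^+ 2 - q ^+ 2 = (p - q) * (p + q) by ring.
  have h6 : (p - q) * (p + q) <= (L2 * e) * (p + q).
    by apply: ler_wpM2r; [exact: addr_ge0|lra].
  have h7 : (L2 * e) * (p + q) <= (L2 * e) * (2 * p + L2).
    by apply: ler_wpM2l; [rewrite mulr_ge0 // ltW|lra].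
  lra.
have := hD k' (fun j => (hk' j).1); have := ler_wpM2l (sqr_ge0 r) n1; lra.
Qed.

(** Such a [k] is a sum of vectors with a single nonzero coordinate [c *: sigma a h], each of them
    cyclic. *)
Lemma slow_dense Y (q : R) : mstar Y = Y -> 0 <= q ->
  (forall d, nm (ip (sv Y d) (sv Y d)) <= q * nm (ip d d)) ->
  forall k, (forall j, D (k j)) -> slow sigma Y q k.
Proof.
move=> Ys q0 hq k kD.
have sl_sum (I : finType) (F : I -> 'I_n -> H) :
    (forall i, slow sigma Y q (F i)) -> slow sigma Y q (\sum_i F i).
  move=> hF; apply: (big_ind (slow sigma Y q)) => [|? ?|i _] //.
    exact: slow0.
  exact: slowD.
have -> : k = \sum_j (fun i => if i == j then k j else 0).
  apply/funext => i; rewrite fct_sumE (bigD1 i) //= eqxx big1 ?addr0 // => j.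
  by rewrite eq_sym => /negPf ->.
apply: (sl_sum) => j; have [m [c [dd [hd ->]]]] := kD j.
have -> : (fun i => if i == j then \sum_(l < m) c l *: dd l else 0) =
    \sum_(l < m) (fun i : 'I_n => if i == j then c l *: dd l else 0).
  apply/funext => i; rewrite fct_sumE; case: (i == j) => //.
  by rewrite big1.
apply: sl_sum => l; have [a [h ->]] := hd l.
have -> : (fun i => if i == j then c l *: sigma a h else 0) =
    (fun i => sigma (if i == j then a else 0) (c l *: h)).
  by apply/funext => i; case: ifP; rewrite ?(op0 (sigL sigmaP)) ?bopZ.
exact: slow_cyclic.
Qed.

Lemma sv_sqr Y d i : sv Y (sv Y d) i = d i - va (Y + Y - mm Y Y) d i.
Proof.
rewrite /sv /va !fctE.
have -> : \sum_j Y i j ** (d j - \sum_l Y j l ** d l) =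
    \sum_j Y i j ** d j - va Y (va Y d) i.
  by rewrite /va -sumrB; apply: eq_bigr => j _; rewrite amulBr.
have -> : \sum_j (Y + Y - mm Y Y) i j ** d j =
    \sum_j Y i j ** d j + \sum_j Y i j ** d j - va (mm Y Y) d i.
  rewrite /va -big_split -sumrB; apply: eq_bigr => j _.
  by rewrite 2!mxE [X in _ + X]mxE amulBl amulDl.
by rewrite va_mm; lcomb C.
Qed.

Lemma sh_sqr Y k i : sh sigma Y (sh sigma Y k) i = k i - ha (Y + Y - mm Y Y) k i.
Proof.
rewrite /sh !fctE ha_sub (ha_mm sigmaP).
have -> : ha (Y + Y - mm Y Y) k i = ha Y k i + ha Y k i - ha (mm Y Y) k i.
  rewrite /ha -big_split -sumrB; apply: eq_bigr => j _.
  by rewrite 2!mxE [X in _ + X]mxE (opB (sigL sigmaP)) (opD (sigL sigmaP)).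
by lcomb C.
Qed.

(* With [s = (1 + X^* X / M)^(1/2)] over the unitization, the hypothesis gives
   [|<s d, s d>| <= q |<d, d>|] for [q = 1 + r^2 / M], so [|s^m k|^2] is
   [O(q^m)] on a dense set of [k]; as [m |-> |s^m k|^2] is log-convex on a
   Hilbert space, [|s k|^2 <= q |k|^2]. *)
Lemma sig_completely_contractive X (r : R) :
  (forall d, nm (ip (va X d) (va X d)) <= r ^+ 2 * nm (ip d d)) ->
  forall k, hn2 (ha X k) <= r ^+ 2 * hn2 k.
Proof.
move=> hX; apply: hn2_le_dense => k kD.
(* This [M] makes [B = - b / M] of norm at most [1/2], below the [3/4] allowed for radius [1/2];
   then [(1 - Y)^2 = 1 + b / M]. *)
pose b := mm (mstar X) X; pose M : R := 2 * nrm b + 1.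
have b0 := nrm_ge0 b.
have M0 : 0 < M by rewrite /M; lra.
have M1 : 0 < M^-1 by rewrite invr_gt0.
pose B : 'M[A]_n := map_mx (fun x : A => - (M^-1%:C *: x)) b.
have [||||Y [Ys BY _]] := @sqrt_one_sub R A n B 2^-1.
- by lra.
- by lra.
- have bs : mstar b = b by rewrite mstarM mstarK.
  apply/matrixP => i j; rewrite mxE [B j i]mxE [B i j]mxE starN starZR.
  by have /matrixP/(_ i j) := bs; rewrite [mstar b i j]mxE => ->.
- have -> : nrm B = M^-1 * nrm b.
    rewrite /nrm mulr_sumr; apply: eq_bigr => i _; rewrite mulr_sumr.
    by apply: eq_bigr => j _; rewrite mxE nmN nmZR // ltW.
  rewrite ler_pdivrMl // /M; lra.
pose q : R := 1 + r ^+ 2 * M^-1.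
have q0 : 0 < q by rewrite ltr_wpDr // mulr_ge0 ?sqr_ge0 ?ltW.
have svq d : nm (ip (sv Y d) (sv Y d)) <= q * nm (ip d d).
  have -> : ip (sv Y d) (sv Y d) = ip d (sv Y (sv Y d)).
    have svE e e' : ip (sv Y e) e' = ip e e' - ip (va Y e) e'.
      by rewrite /ip -sumrB; apply: eq_bigr => i _; rewrite starB amulBl.
    have svE' e e' : ip e (sv Y e') = ip e e' - ip e (va Y e').
      by rewrite /ip -sumrB; apply: eq_bigr => i _; rewrite amulBr.
    by rewrite svE [RHS]svE' va_adj Ys.
  have -> : ip d (sv Y (sv Y d)) = ip d d + M^-1%:C *: ip (va X d) (va X d).
    rewrite [X in _ + _ *: X]va_adj /ip scaler_sumr -big_split.
    apply: eq_bigr => i _ /=; rewrite va_mm sv_sqr -BY amulBr; congr (_ + _).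
    rewrite -amulZr -amulNr /va scaler_sumr -sumrN; congr (_ ** _).
    by apply: eq_bigr => j _; rewrite mxE amulNl amulZl opprK.
  apply: le_trans (nmD _ _) _; rewrite nmZR ?(ltW M1) // /q mulrDl mul1r lerD2l.
  by have := ler_wpM2l (ltW M1) (hX d); lra.
(* Compared with the bound [q * hn2 k], this identity leaves exactly the claim times [M^-1]. *)
have shE : hn2 (sh sigma Y k) = hn2 k + M^-1 * hn2 (ha X k).
  rewrite -!hipxx (sh_adj sigmaP Ys) (ha_adj sigmaP) /hip mulr_sumr -big_split.
  apply: eq_bigr => i _ /=; rewrite sh_sqr -BY rdotBr (ha_mm sigmaP); congr (_ + _).
  rewrite -rdotNr -rdotZr; congr (rdot _ _); rewrite /ha scaler_sumr -sumrN.
  apply: eq_bigr => j _; rewrite mxE.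
  by rewrite (opN (sigL sigmaP)) (opZ (sigL sigmaP)) opprK.
have [K hK] := slow_dense Ys (ltW q0) svq kD.
have := convex_growth q0 (sh_convex sigmaP Ys k q) hK.
rewrite [X in X <= _]shE /= /q => h.
have {}h : M^-1 * hn2 (ha X k) <= M^-1 * (r ^+ 2 * hn2 k) by lra.
by rewrite ler_pM2l in h.
Qed.

End CompleteContractivity.

(** * Interior tensor products with automorphism correspondences *)

Section Tensors.
Variables (R : realType) (A : cstarAlgType R) (H : hilbertType R).
Variable sigma : A -> bop H H.
Hypotheses (sigmaP : star_rep sigma) (sigma_nd : nondegenerate_rep sigma).
Local Notation C := R[i].
Local Infix "**" := (@amul R A) (at level 40, left associativity).

(** Scalars are absorbed into the argument in [A], so sums over lists of pairs already exhaust the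
    linear span. *)
Lemma bop_extend_gen (V : normedModType C) (W : completeNormedModType C)
    (f : A -> H -> V) (g : A -> H -> W) :
  (forall c a h, f (c *: a) h = c *: f a h) ->
  (forall c a h, g (c *: a) h = c *: g a h) ->
  dense (lspan [set v | exists a h, v = f a h]) ->
  (forall s : seq (A * H),
     nm (\sum_(p <- s) g p.1 p.2) <= nm (\sum_(p <- s) f p.1 p.2)) ->
  exists F : bop V W, forall a h, F (f a h) = g a h.
Proof.
move=> fZ gZ fd fg.
pose P v w := exists s : seq (A * H),
  v = \sum_(p <- s) f p.1 p.2 /\ w = \sum_(p <- s) g p.1 p.2.
have [||||F hF] := @bop_extend R V W P 1.
- move=> c _ _ _ _ [s [-> ->]] [s' [-> ->]].
  exists ([seq (c *: p.1, p.2) | p <- s] ++ s').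
  rewrite !big_cat !big_map /= !scaler_sumr.
  by split; congr (_ + _); apply: eq_bigr => p _; rewrite ?fZ ?gZ.
- move=> x e e0; have [_ [n [c [d [hd ->]]]] xy] := dense_nm fd x e0.
  have /choice [p hp] : forall i, exists p : A * H, d i = f p.1 p.2.
    by move=> i; have [a [h ->]] := hd i; exists (a, h).
  pose s := [seq (c i *: (p i).1, (p i).2) | i <- index_enum 'I_n].
  exists (\sum_(q <- s) f q.1 q.2), (\sum_(q <- s) g q.1 q.2); split.
    by exists s.
  apply: le_trans (ltW xy); rewrite big_map le_eqVlt; apply/orP; left.
  by apply/eqP; congr (nm (_ - _)); apply: eq_bigr => i _; rewrite fZ hp.
- by [].
- by move=> _ _ [s [-> ->]]; rewrite mul1r.
exists F => a h; apply: hF; exists [:: (a, h)].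
by rewrite !big_seq1.
Qed.

(** [u = x - y] is orthogonal to the span, so [|u| <= |u - z|] for every [z] in it. *)
Lemma hdot_inj_dense (K : hilbertType R) (D : set K) (x y : K) :
  dense (lspan D) -> (forall w, D w -> hdot x w = hdot y w) -> x = y.
Proof.
move=> dD xy; apply: nm_small_eq => e e0.
have [_ [n [c [d [Dd ->]]]]] := dense_nm dD (x - y) e0.
set z := \sum_i _ => /ltW; set u := x - y => uz.
have u0 : rdot u z = 0.
  rewrite /rdot hdot_sumr big1 // => i _.
  by rewrite hdotZr hdotDl hdotNl xy // subrr mulr0.
apply: le_trans uz; rewrite -(@ler_pXn2r _ 2) ?nnegrE ?nm_ge0 //.
by rewrite (nmB_sqr u z) u0; have := sqr_ge0 (nm z); lra.
Qed.

Lemma sig_eq (W : normedModType C) (f g : bop H W) :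
  (forall a h, f (sigma a h) = g (sigma a h)) -> f =1 g.
Proof. by move=> fg; apply: (bop_eq_dense sigma_nd) => _ [a [h ->]]. Qed.

Lemma bop_id (V : normedModType C) : exists f : bop V V, f =1 id.
Proof. by apply: (@bop_of_bounded _ _ _ id 1) => [c x y|x]; rewrite ?mul1r. Qed.

(** The identification with [H]. As [beta] enters only the left action, all these tensor products
    share one model. *)
Definition tens_unitary (beta : star_aut A) (X : int_tensor sigma (autcorr beta))
    (V : bop X H) :=
  [/\ forall a h, V (tens X a h) = sigma a h,
      forall a h, adj V (sigma a h) = tens X a h,
      forall y, V (adj V y) = y & forall x, adj V (V x) = x].

Lemma tens_unitary_exists (beta : star_aut A) (X : int_tensor sigma (autcorr beta)) :
  exists V : bop X H, tens_unitary V.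
Proof.
have tZ c (a : A) h : tens X (c *: a) h = c *: tens X a h.
  have h0 : tens X (0 : A) h = 0.
    by apply: (addrI (tens X (0 : A) h)); have := tens_linl X h 1 (0 : A) (0 : A);
      rewrite /= !scale1r !addr0.
  by have := tens_linl X h c a (0 : A); rewrite /= h0 !addr0.
have dotE a h b l : hdot (tens X a h) (tens X b l) = hdot (sigma a h) (sigma b l).
  by rewrite tens_dot (sig_adj sigmaP) -(sigM sigmaP).
have [||||V VE] := @bop_extend_gen X H (fun a h => tens X a h) (fun a h => sigma a h).
- exact: tZ.
- by move=> c a h; rewrite (opZ (sigL sigmaP)).
- exact: (@tens_total _ _ _ _ _ X).
- move=> s; rewrite -(@ler_pXn2r _ 2) ?nnegrE ?nm_ge0 // -!rdotxx /rdot.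
  rewrite !hdot_suml le_eqVlt; apply/orP; left; apply/eqP; congr (Re _).
  by apply: eq_bigr => p _; rewrite !hdot_sumr; apply: eq_bigr => q _; rewrite dotE.
have V'E a h : adj V (sigma a h) = tens X a h.
  apply: (hdot_inj_dense (@tens_total _ _ _ _ _ X)) => _ [b [l ->]].
  by rewrite adjE VE dotE.
exists V; split=> //.
- have [f fE] := bop_comp V (adj V); have [i iE] := bop_id H.
  by move=> y; rewrite -[V _]fE -[RHS]iE; apply: sig_eq => a h; rewrite fE iE /= V'E VE.
have [f fE] := bop_comp (adj V) V; have [i iE] := bop_id X.
move=> y; rewrite -[adj V _]fE -[RHS]iE.
apply: (bop_eq_dense (@tens_total _ _ _ _ _ X)) => _ [b [l ->]].
by rewrite fE iE /= VE V'E.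
Qed.

Lemma adj_comp (K L M : hilbertType R) (f : bop K M) (g : bop L M) (h : bop K L) :
  f =1 g \o h -> adj f =1 adj h \o adj g.
Proof.
move=> fE y; apply: hdot_inj => w.
by rewrite adjE fE /= !adjE.
Qed.

Section Formulas.
Variables (b1 b4 : star_aut A).
Variables (X1 : int_tensor sigma (autcorr b1)) (X4 : int_tensor sigma (autcorr b4)).
Variables (V1 : bop X1 H) (V4 : bop X4 H).
Hypotheses (V1P : tens_unitary V1) (V4P : tens_unitary V4).

Lemma tens_eq (W : normedModType C) (f g : bop X1 W) :
  (forall a h, f (tens X1 a h) = g (tens X1 a h)) -> f =1 g.
Proof.
by move=> fg; apply: (bop_eq_dense (@tens_total _ _ _ _ _ X1)) => _ [a [h ->]].
Qed.

(** The scheme of all formulas below: an explicit operator with the prescribed values shows that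
    [get] selects one, and a density argument identifies the two. *)
Lemma tildeE (T : autcorr b1 -> bop H H) (S : bop H H) :
  (forall a, T a =1 S \o sigma a) -> tilde X1 T =1 S \o V1.
Proof.
move=> TS; have [V1t _ _ _] := V1P; have [f fE] := bop_comp S V1.
have fP : forall x h, f (tens X1 x h) = T x h.
  by move=> x h; rewrite fE /= V1t TS.
have tP := @getPex _ [set f : bop X1 H | forall x h, f (tens X1 x h) = T x h]
  (ex_intro _ f fP).
by move=> x; rewrite -fE; apply: tens_eq => a h; rewrite fP; apply: tP.
Qed.

Lemma ampE (u : bop H H) : (forall a, u \o sigma a =1 sigma a \o u) ->
  amp X1 u =1 adj V1 \o u \o V1.
Proof.
move=> us; have [V1t V1s _ _] := V1P.
have [g gE] := bop_comp u V1; have [f fE] := bop_comp (adj V1) g.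
have fP : forall x h, f (tens X1 x h) = tens X1 x (u h).
  by move=> x h; rewrite fE /= gE /= V1t -[u _]/((u \o sigma x) h) us /= V1s.
have tP := @getPex _ [set f : bop X1 X1 | forall x h, f (tens X1 x h) = tens X1 x (u h)]
  (ex_intro _ f fP).
move=> x; rewrite /= -[u (V1 x)]gE -[RHS]fE.
by apply: tens_eq => a h; rewrite fP; apply: tP.
Qed.

Lemma tens_opE (t : bop (autcorr b1) (autcorr b4)) (u : bop H H) :
  (forall x, t x = x :> A) -> (forall a, u \o sigma a =1 sigma a \o u) ->
  tens_op X1 X4 t u =1 adj V4 \o u \o V1.
Proof.
move=> tx us; have [V1t _ _ _] := V1P; have [_ V4s _ _] := V4P.
have [g gE] := bop_comp u V1; have [f fE] := bop_comp (adj V4) g.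
have fP : forall x h, f (tens X1 x h) = tens X4 (t x) (u h).
  by move=> x h; rewrite fE /= gE /= V1t -[u _]/((u \o sigma x) h) us /= V4s tx.
have tP := @getPex _ [set f : bop X1 X4 |
    forall x h, f (tens X1 x h) = tens X4 (t x) (u h)]
  (ex_intro _ f fP).
move=> x; rewrite /= -[u (V1 x)]gE -[RHS]fE.
by apply: tens_eq => a h; rewrite fP; apply: tP.
Qed.

End Formulas.

Section Balanced.
Variables (b1 b2 b3 : star_aut A).
Variables (X1 : int_tensor sigma (autcorr b1)) (X2 : int_tensor sigma (autcorr b2)).
Variables (X3 : int_tensor sigma (autcorr b3)).
Variables (V1 : bop X1 H) (V2 : bop X2 H) (V3 : bop X3 H).
Hypotheses (V1P : tens_unitary V1) (V2P : tens_unitary V2) (V3P : tens_unitary V3).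
Variable m : autcorr b1 -> autcorr b2 -> autcorr b3.
Hypothesis mE : forall x y, m x y = b2 x ** y :> A.

(** In the model, [x (x) (y (x) h)] is [sigma (b2 x ** y) h]. *)
Lemma creE (x : autcorr b1) : cre m X2 X3 x =1 adj V3 \o sigma (b2 x) \o V2.
Proof.
have [V2t _ _ _] := V2P; have [_ V3s _ _] := V3P.
have [g gE] := bop_comp (sigma (b2 x)) V2; have [f fE] := bop_comp (adj V3) g.
have fP : forall y h, f (tens X2 y h) = tens X3 (m x y) h.
  by move=> y h; rewrite fE /= gE /= V2t -(sigM sigmaP) V3s mE.
have tP := @getPex _ [set f : bop X2 X3 | forall y h, f (tens X2 y h) = tens X3 (m x y) h]
  (ex_intro _ f fP).
move=> w; rewrite /= -[sigma _ _]gE -[RHS]fE.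
by apply: tens_eq => a h; rewrite fP; apply: tP.
Qed.

Lemma amp_fromE (v : bop X2 H) (S : bop H H) : v =1 S \o V2 ->
  (forall a, sigma a \o S =1 S \o sigma (b2 a)) ->
  amp_from m X1 X3 v =1 adj V1 \o S \o V3.
Proof.
move=> vE Sa; have [_ V1s _ _] := V1P; have [_ _ V2K _] := V2P.
have [_ _ V3K V3K'] := V3P.
have [g gE] := bop_comp S V3; have [f fE] := bop_comp (adj V1) g.
have fP : forall x w, f (cre m X2 X3 x w) = tens X1 x (v w).
  by move=> x w; rewrite fE /= gE /= creE /= V3K -[S _]/((S \o _) _) -Sa /= V1s vE.
have tP := @getPex _ [set f : bop X3 X1 |
    forall x w, f (cre m X2 X3 x w) = tens X1 x (v w)]
  (ex_intro _ f fP).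
(* Uniqueness: [adj V3 (sigma a h)] is [cre x w] for [x] the preimage of [a] under [b2] and
   [w = adj V2 h]. *)
have [f1 f1E] := bop_comp f (adj V3).
have [t1 t1E] := bop_comp (amp_from m X1 X3 v) (adj V3).
have tf : t1 =1 f1.
  apply: sig_eq => a h; have := fP (aut_inv b2 a) (adj V2 h).
  have := tP (aut_inv b2 a) (adj V2 h); rewrite !creE /= aut_invK V2K.
  by rewrite t1E f1E /= => -> ->.
move=> x; rewrite /= -[S (V3 x)]gE -[RHS]fE -(V3K' x).
by have := tf (V3 x); rewrite t1E f1E.
Qed.

Lemma sig_adj_comm (S : bop H H) (b : star_aut A) :
  (forall a, sigma a \o S =1 S \o sigma (b a)) ->
  forall a, sigma (b a) \o adj S =1 adj S \o sigma a.
Proof.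
move=> Sa a h; apply: hdot_inj => w /=.
rewrite adjE !(sig_adj sigmaP) adjE -aut_star.
by rewrite -[S (sigma _ _)]/((S \o sigma _) w) -Sa.
Qed.

Lemma amp_toE (v : bop H X2) (S : bop H H) : v =1 adj V2 \o adj S ->
  (forall a, sigma a \o S =1 S \o sigma (b2 a)) ->
  amp_to m X1 X3 v =1 adj V3 \o adj S \o V1.
Proof.
move=> vE Sa; have [V1t _ _ _] := V1P; have [_ _ V2K _] := V2P.
have [g gE] := bop_comp (adj S) V1; have [f fE] := bop_comp (adj V3) g.
have fP : forall x h, f (tens X1 x h) = cre m X2 X3 x (v h).
  move=> x h; rewrite fE /= gE /= V1t creE /= vE /= V2K.
  by rewrite -[sigma _ (adj S h)]/((sigma (b2 x) \o adj S) h) sig_adj_comm.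
have tP := @getPex _ [set f : bop X1 X3 |
    forall x h, f (tens X1 x h) = cre m X2 X3 x (v h)]
  (ex_intro _ f fP).
move=> x; rewrite /= -[adj S (V1 x)]gE -[RHS]fE.
by apply: tens_eq => a h; rewrite fP; apply: tP.
Qed.
End Balanced.

(** Both [a (x) b] and its flip are identified with [alpha_j(a) b]. So the flip fixes products,
    which are dense by [approx_unit]. *)
Lemma aut_flipE k (alpha : 'I_k -> star_aut A) i j (x : aut_fib2 alpha i j) :
  aut_flip alpha i j x = x :> A.
Proof.
have [f fE] := bop_id A.
have fP : forall a b, (f : bop (aut_fib2 alpha i j) (aut_fib2 alpha j i))
    (aut_bal (alpha := alpha) (i := i) (j := j) a b) =
    aut_bal (alpha := alpha) (i := j) (j := i) (aut_inv (alpha i) (alpha j a)) b.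
  by move=> a b; rewrite [LHS]fE /aut_bal aut_invK.
have tP := @getPex _ [set t : bop (aut_fib2 alpha i j) (aut_fib2 alpha j i) |
  forall a b, t (@aut_bal R A k alpha i j a b) =
    @aut_bal R A k alpha j i (aut_inv (alpha i) (alpha j a)) b]
  (ex_intro _ f fP).
have tM (a b : A) : aut_flip alpha i j (a ** b) = a ** b.
  by have := tP (aut_inv (alpha j) a) b; rewrite /aut_bal !aut_invK.
have [K K0 hK] := bop_bounded (aut_flip alpha i j).
apply: nm_small_eq => e e0.
have d0 : 0 < e / (K + 1) by apply: divr_gt0; lra.
have dE : e / (K + 1) * (K + 1) = e by rewrite divfK //; lra.
have [f1 f11 hf1] := approx_unit [:: (x : A)] d0.
have {}hf1 := hf1 x (mem_head _ _).
have -> : aut_flip alpha i j x - x = aut_flip alpha i j (x - f1 ** x) - (x - f1 ** x).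
  by rewrite bopB tM opprB addrA subrK.
apply: le_trans (nmD _ _) _; rewrite nmN.
have := hK (x - f1 ** x); have := ler_wpM2l K0 hf1; lra.
Qed.

End Tensors.

(** * The implementing contractions *)

Section Implementing.
Variables (R : realType) (A : cstarAlgType R) (H : hilbertType R).
Variable sigma : A -> bop H H.
Hypotheses (sigmaP : star_rep sigma) (sigma_nd : nondegenerate_rep sigma).
Variable alpha : star_aut A.
Local Notation C := R[i].
Local Infix "**" := (@amul R A) (at level 40, left associativity).

(** The right action being multiplication, [corr_mxnorm_le] is the hypothesis of
    [sig_completely_contractive]; [S] then acts on each coordinate. *)
Lemma completely_contractive_comp (T : autcorr alpha -> bop H H) (S : bop H H) :
  contractive S -> (forall a, T a =1 S \o sigma a) -> completely_contractive T.
Proof.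
move=> Sc TS n xi r r0 hxi h.
have [q rE] : exists q : R, r = q%:C.
  by exists (Re r); rewrite RRe_real // ger0_real.
pose X : 'M[A]_n := \matrix_(i, j) xi i j.
have hX d : nm (ip (va X d) (va X d)) <= q ^+ 2 * nm (ip d d).
  have := hxi d; rewrite /= rE -rmorphXn /= !nmE -rmorphM lecR.
  have -> : ip (va X d) (va X d) = \sum_(i < n)
      star (\sum_(j < n) xi i j ** d j) ** (\sum_(j < n) xi i j ** d j).
    apply: eq_bigr => i _.
    by have -> : va X d i = \sum_(j < n) xi i j ** d j
      by apply: eq_bigr => j _; rewrite mxE.
  by [].
have := sig_completely_contractive sigmaP sigma_nd hX h.
have sqE (F : 'I_n -> H) : \sum_(i < n) `|F i| ^+ 2 = (hn2 F)%:C.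
  by rewrite rmorph_sum; apply: eq_bigr => i _; rewrite nmE -rmorphXn.
rewrite /bop_mxnorm_le rE -rmorphXn !sqE -rmorphM lecR; apply: le_trans.
apply: ler_sum => i _.
have -> : \sum_j T (xi i j) (h j) = S (ha sigma X h i).
  by rewrite bop_sum; apply: eq_bigr => j _; rewrite TS mxE.
by rewrite ler_pXn2r ?nnegrE ?nm_ge0 // -nm_le.
Qed.

Lemma completely_contractive_nm (T : autcorr alpha -> bop H H) (x : A) h :
  completely_contractive T -> nm (T x h) <= nm x * nm h.
Proof.
move=> /(_ 1 (fun _ _ => x) (nm x)%:C); rewrite ler0c nm_ge0 => /(_ isT) Tc.
have /Tc /(_ (fun _ => h)) :
    corr_mxnorm_le (fun _ _ : 'I_1 => (x : autcorr alpha)) (nm x)%:C.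
  move=> c /=; rewrite !big_ord1 -rmorphXn /= !nmE -rmorphM lecR /=.
  rewrite !nm_starM -exprMn ler_pXn2r ?nnegrE ?nm_ge0 ?mulr_ge0 ?nm_ge0 //.
  exact: nmM.
rewrite !big_ord1 !nmE -!rmorphXn -rmorphM lecR -exprMn.
by rewrite ler_pXn2r ?nnegrE ?mulr_ge0 ?nm_ge0.
Qed.

Section FromT.
Variable T : A -> bop H H.
Hypothesis TL : op_linear T.
Hypothesis Tn : forall x h, nm (T x h) <= nm x * nm h.
Hypothesis Tcov : forall a x b, T (alpha a ** (x ** b)) =1 sigma a \o T x \o sigma b.

(** [Tcov] concerns two-sided products only; their density yields the one-sided rules [T_right] and
    [T_left]. Bijectivity of [alpha] lets the left approximate unit be written [alpha a]. *)
Lemma approx_two_sided x (d : R) : 0 < d ->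
  exists a b, nm (x - alpha a ** (x ** b)) <= d.
Proof.
move=> d0; have d20 : 0 < d / 2 by rewrite divr_gt0.
have [e e1 he] := approx_unit [:: x] d20.
have [f _ hf] := approx_unit [:: star x] d20.
exists (aut_inv alpha e), (star f); rewrite aut_invK.
apply: le_trans (nm_triangle _ (e ** x) _) _.
have := he x (mem_head _ _); have := hf (star x) (mem_head _ _).
rewrite -amulBr -[nm (star x - _)]nm_star starB starM !starK => h1 h2.
by have := nmM e (x - x ** star f); have := nm_ge0 (x - x ** star f); nra.
Qed.

Lemma eq_of_eq_two_sided (F G : A -> H) (K L : R) x :
  (forall y z, F (y - z) = F y - F z) -> (forall y z, G (y - z) = G y - G z) ->
  0 <= K -> 0 <= L ->
  (forall y, nm (F y) <= K * nm y) -> (forall y, nm (G y) <= L * nm y) ->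
  (forall a b, F (alpha a ** (x ** b)) = G (alpha a ** (x ** b))) -> F x = G x.
Proof.
move=> FB GB K0 L0 FK GL FG; apply: nm_small_eq => e e0.
have d0 : 0 < e / (K + L + 1) by apply: divr_gt0; lra.
have dE : e / (K + L + 1) * (K + L + 1) = e by rewrite divfK //; lra.
have [a [b hab]] := approx_two_sided x d0; set y := alpha a ** _ in hab.
have -> : F x - G x = F (x - y) - G (x - y).
  by rewrite FB GB FG opprB addrA subrK.
apply: le_trans (nmD _ _) _; rewrite nmN.
have := FK (x - y); have := GL (x - y).
have := ler_wpM2l (addr_ge0 K0 L0) hab; lra.
Qed.

Lemma T_right x b h : T (x ** b) h = T x (sigma b h).
Proof.
apply: (@eq_of_eq_two_sided (fun y => T (y ** b) h) (fun y => T y (sigma b h))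
  (nm b * nm h) (nm (sigma b h))).
- by move=> y z; rewrite amulBl (opB TL).
- by move=> y z; rewrite (opB TL).
- by rewrite mulr_ge0 ?nm_ge0.
- exact: nm_ge0.
- move=> y; apply: le_trans (Tn _ _) _; rewrite mulrC [leRHS]mulrAC.
  by rewrite [leRHS]mulrC ler_wpM2l ?nm_ge0 // mulrC nmM.
- by move=> y; rewrite mulrC.
by move=> a c; rewrite -!amulA !Tcov /= (sigM sigmaP).
Qed.

Lemma T_left x a h : T (alpha a ** x) h = sigma a (T x h).
Proof.
have [K K0 hK] := bop_bounded (sigma a).
apply: (@eq_of_eq_two_sided (fun y => T (alpha a ** y) h) (fun y => sigma a (T y h))
  (nm (alpha a) * nm h) (K * nm h)).
- by move=> y z; rewrite amulBr (opB TL).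
- by move=> y z; rewrite (opB TL) bopB.
- by rewrite mulr_ge0 ?nm_ge0.
- by rewrite mulr_ge0 ?nm_ge0.
- move=> y; apply: le_trans (Tn _ _) _; rewrite [leRHS]mulrAC.
  by rewrite ler_wpM2r ?nm_ge0 // nmM.
- move=> y; apply: le_trans (hK _) _; rewrite -mulrA ler_wpM2l //.
  by rewrite mulrC.
by move=> c b; rewrite amulA -autM !Tcov /= (sigM sigmaP).
Qed.

Lemma implementing_operator : exists S : bop H H,
  [/\ contractive S, forall a, T a =1 S \o sigma a &
      forall a, sigma a \o S =1 S \o sigma (alpha a)].
Proof.
have bound (s : seq (A * H)) :
    nm (\sum_(p <- s) T p.1 p.2) <= nm (\sum_(p <- s) sigma p.1 p.2).
  set v := \sum_(p <- s) sigma _ _.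
  pose L : R := \sum_(p <- s) nm p.2.
  have L0 : 0 <= L by apply: sumr_ge0 => p _; apply: nm_ge0.
  apply/ler_addgt0Pr => e e0.
  have d0 : 0 < e / (L + 1) by apply: divr_gt0; lra.
  have dE : e / (L + 1) * (L + 1) = e by rewrite divfK //; lra.
  have [f f1 hf] := approx_unit [seq p.1 | p <- s] d0.
  (* By [T_right] the terms [T (f ** a) h] collect into [T f v], of norm at most [nm v]; the rest is
     small. *)
  have -> : \sum_(p <- s) T p.1 p.2 = T f v + \sum_(p <- s) T (p.1 - f ** p.1) p.2.
    rewrite /v bop_sum -big_split; apply: eq_bigr => p _ /=.
    by rewrite (opB TL) T_right addrC subrK.
  apply: le_trans (nmD _ _) _; apply: lerD.
    by apply: le_trans (Tn _ _) _; rewrite ler_piMl ?nm_ge0.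
  apply: le_trans (nm_sum _ _ _) _.
  apply: (@le_trans _ _ (\sum_(p <- s) e / (L + 1) * nm p.2)).
    rewrite big_seq [leRHS]big_seq; apply: ler_sum => p ps.
    apply: le_trans (Tn _ _) _; apply: ler_wpM2r; first exact: nm_ge0.
    by apply: hf; apply: map_f.
  by rewrite -mulr_sumr -/L; have := ltW d0; lra.
have [||||S hS] := @bop_extend_gen R A H H H (fun a h => sigma a h) (fun a h => T a h).
- by move=> c a h; rewrite (opZ (sigL sigmaP)).
- by move=> c a h; rewrite (opZ TL).
- exact: sigma_nd.
- exact: bound.
have Sd s : S (\sum_(p <- s) sigma p.1 p.2) = \sum_(p <- s) T p.1 p.2.
  by rewrite bop_sum; apply: eq_bigr => p _; rewrite hS.
exists S; split.
- move=> x; rewrite nm_le; apply/ler_addgt0Pr => e e0.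
  have [K K0 hK] := bop_bounded S.
  have d0 : 0 < e / (K + 1) by apply: divr_gt0; lra.
  have dE : e / (K + 1) * (K + 1) = e by rewrite divfK //; lra.
  have [_ [n [c [d [hd ->]]]]] := dense_nm sigma_nd x d0.
  have /choice [p hp] : forall i, exists p : A * H, d i = sigma p.1 p.2.
    by move=> i; have [a [h ->]] := hd i; exists (a, h).
  pose s := [seq (c i *: (p i).1, (p i).2) | i <- index_enum 'I_n].
  have -> : \sum_(i < n) c i *: d i = \sum_(q <- s) sigma q.1 q.2.
    by rewrite big_map; apply: eq_bigr => i _; rewrite (opZ (sigL sigmaP)) hp.
  set y := \sum_(q <- s) _ => xy.
  have : nm (S y) <= nm y by rewrite Sd bound.
  have := nmD (S x - S y) (S y); have := nmD (y - x) x.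
  rewrite !subrK -bopB [nm (y - x)]nmB; have := hK (x - y).
  have := ler_wpM2l K0 (ltW xy); lra.
- by move=> a h; rewrite /= hS.
move=> a; have [f fE] := bop_comp (sigma a) S.
have [g gE] := bop_comp S (sigma (alpha a)).
move=> x; rewrite -fE -gE; apply: (sig_eq sigma_nd) => b h.
by rewrite fE gE /= -(sigM sigmaP) !hS T_left.
Qed.

End FromT.
End Implementing.

(** * The twisted relations in terms of the implementing operators *)

Section Twisted.
Variables (R : realType) (A : cstarAlgType R) (k : nat).
Variables (alpha : 'I_k -> star_aut A) (H : hilbertType R).
Variable sigma : A -> bop H H.
Hypotheses (sigmaP : star_rep sigma) (sigma_nd : nondegenerate_rep sigma).
Variable T : forall i, autcorr (alpha i) -> bop H H.
Variable U : 'I_k -> 'I_k -> bop H H.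
Hypothesis U_sigma : forall i j a, i != j -> U i j \o sigma a =1 sigma a \o U i j.
Hypothesis U_T : forall i j l a, i != j -> U i j \o @T l a =1 @T l a \o U i j.
Variable X : forall i, int_tensor sigma (autcorr (alpha i)).
Variable XX : forall i j, int_tensor sigma (aut_fib2 alpha i j).
Variable S : 'I_k -> bop H H.
Hypothesis TS : forall i a, @T i a =1 S i \o sigma a.
Hypothesis Ssigma : forall i a, sigma a \o S i =1 S i \o sigma (alpha i a).

Let Tt i : bop (X i) H := tilde (X i) (@T i).
Let ITt i j : bop (XX i j) (X i) :=
  amp_from (@aut_bal R A k alpha i j) (X i) (XX i j) (Tt j).
Let ITts i j : bop (X i) (XX i j) :=
  amp_to (@aut_bal R A k alpha i j) (X i) (XX i j) (adj (Tt j)).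
Let twist i j : bop (XX i j) (XX j i) :=
  tens_op (XX i j) (XX j i) (aut_flip alpha i j) (U i j).

Lemma U_S i j l x : i != j -> U i j (S l x) = S l (U i j x).
Proof.
move=> ij; have [f fE] := bop_comp (U i j) (S l); have [g gE] := bop_comp (S l) (U i j).
rewrite -[LHS]fE -[RHS]gE; apply: (sig_eq sigma_nd) => a h; rewrite fE gE /=.
have := @U_T i j l a ij h; rewrite /= !TS /= => ->.
by have := U_sigma a ij h; rewrite /= => ->.
Qed.

(** Conjugation by the unitaries [V] and [W] turns [Tt i] into [S i], [ITt i j] into [S j],
    [ITts i j] into [adj (S j)] and [twist i j] into [U i j], which [U_S] moves to the front. *)
Lemma twisted_relations : exists (V : forall i, bop (X i) H),
  [/\ forall i, tens_unitary (V i),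
   forall i x, Tt i x = S i (V i x),
   forall i j, i != j ->
     (Tt i \o ITt i j =1 Tt j \o ITt j i \o twist i j <->
      S i \o S j =1 U i j \o S j \o S i) &
   forall i j, i != j ->
     (adj (Tt j) \o Tt i =1 ITt j i \o twist i j \o ITts i j <->
      adj (S j) \o S i =1 U i j \o S i \o adj (S j))].
Proof.
have [V VP] : exists V : forall i, bop (X i) H, forall i, tens_unitary (V i).
  (* A dependent choice: the type of [V i] varies with [i]. *)
  have h i := cid (tens_unitary_exists sigmaP sigma_nd (X i)).
  by exists (fun i => projT1 (h i)) => i; apply: projT2 (h i).
have [W WP] : exists W : forall i j, bop (XX i j) H, forall i j, tens_unitary (W i j).
  have h i j := cid (tens_unitary_exists sigmaP sigma_nd (XX i j)).
  by exists (fun i j => projT1 (h i j)) => i j; apply: projT2 (h i j).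
have TtE i : Tt i =1 S i \o V i by exact: (tildeE (VP i) (@TS i)).
have ITtE i j : ITt i j =1 adj (V i) \o S j \o W i j.
  by apply: (amp_fromE sigmaP sigma_nd (VP i) (VP j) (WP i j) _ (TtE j)).
have ITtsE i j : ITts i j =1 adj (W i j) \o adj (S j) \o V i.
  by apply: (amp_toE sigmaP (VP i) (VP j) (WP i j) _ (adj_comp (TtE j))).
have twistE i j : i != j -> twist i j =1 adj (W j i) \o U i j \o W i j.
  move=> ij; apply: (tens_opE (WP i j) (WP j i)) => [x|a].
    exact: aut_flipE.
  exact: U_sigma.
exists V; split=> // i j ij.
  have [_ _ WK WK'] := WP i j; have [_ _ WjK _] := WP j i.
  have [_ _ ViK _] := VP i; have [_ _ VjK _] := VP j.
  have l x : Tt i (ITt i j x) = S i (S j (W i j x)) by rewrite ITtE TtE /= ViK.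
  have r x : Tt j (ITt j i (twist i j x)) = U i j (S j (S i (W i j x))).
    by rewrite twistE // ITtE TtE /= VjK WjK !U_S.
  split=> h x /=; last by rewrite l r; apply: h.
  by have := h (adj (W i j) x); rewrite /= l r WK.
have [_ _ WK _] := WP i j; have [_ _ WjK _] := WP j i.
have [_ _ ViK ViK'] := VP i; have [_ Vjs VjK VjK'] := VP j.
have l x : adj (Tt j) (Tt i x) = adj (V j) (adj (S j) (S i (V i x))).
  by rewrite (adj_comp (TtE j)) TtE.
have r x : ITt j i (twist i j (ITts i j x)) =
    adj (V j) (U i j (S i (adj (S j) (V i x)))).
  by rewrite ITtsE twistE // ITtE /= WjK WK U_S.
split=> h x /=; last by rewrite l r; congr (adj (V j) _); apply: h.
have := h (adj (V i) x); rewrite /= l r ViK => /(congr1 (V j)).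
by rewrite !VjK.
Qed.

End Twisted.

Theorem theorem5p14 (R : realType) (A : cstarAlgType R) (k : nat)
    (alpha : 'I_k -> star_aut A)
    (alphaC : forall i j, alpha i \o alpha j =1 alpha j \o alpha i)
    (H : hilbertType R) (Hsep : separable H)
    (sigma : A -> bop H H)
    (sigma_rep : star_rep sigma) (sigma_nd : nondegenerate_rep sigma)
    (T : forall i, autcorr (alpha i) -> bop H H)
    (T_linear : forall i, op_linear (@T i))
    (U : 'I_k -> 'I_k -> bop H H)
    (U_unitary : forall i j, i != j -> unitary (U i j))
    (U_comm : forall i j p q, i != j -> p != q ->
       U i j \o U p q =1 U p q \o U i j)
    (U_adj : forall i j, i != j -> U j i =1 adj (U i j))
    (U_sigma : forall i j a, i != j -> U i j \o sigma a =1 sigma a \o U i j)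
    (U_T : forall i j l a, i != j -> U i j \o @T l a =1 @T l a \o U i j)
    (X : forall i, int_tensor sigma (autcorr (alpha i)))
    (XX : forall i j, int_tensor sigma (aut_fib2 alpha i j)) :
  @doubly_twisted R A k (aut_sys alpha) H sigma T U X XX <->
  exists S : 'I_k -> bop H H,
    [/\ forall i, contractive (S i),
        forall i a, @T i a =1 S i \o sigma a,
        forall i a, sigma a \o S i =1 S i \o sigma (alpha i a),
        forall i j, i != j -> S i \o S j =1 U i j \o S j \o S i &
        forall i j, i != j ->
          adj (S i) \o S j =1 adj (U i j) \o S j \o adj (S i)].
Proof.
split=> [[hT hU h3 h4]|[S [Sc TS Ss S3 S4]]].
  have /choice [S hS] : forall i, exists S : bop H H,
      [/\ contractive S, forall a, @T i a =1 S \o sigma a &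
          forall a, sigma a \o S =1 S \o sigma (alpha i a)].
    move=> i; have [TL Tc Tcov] := hT i.
    apply: (@implementing_operator R A H sigma sigma_rep sigma_nd (alpha i) (@T i)).
    - exact: TL.
    - by move=> x h; apply: completely_contractive_nm.
    - exact: Tcov.
  have TS i a : @T i a =1 S i \o sigma a by case: (hS i).
  have Ss i a : sigma a \o S i =1 S i \o sigma (alpha i a) by case: (hS i).
  have [V [_ _ r3 r4]] :=
    twisted_relations sigma_rep sigma_nd U_sigma U_T X XX TS Ss.
  exists S; split=> // [i|i j ij|i j ij]; first by case: (hS i).
    exact/(r3 i j ij)/(h3 i j ij).
  (* The relation for [(j, i)] has the factor [U j i], which is [adj (U i j)]. *)
  have ji : j != i by rewrite eq_sym.
  move=> x; have /(r4 j i ji)/(_ x) := h4 j i ji.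
  by rewrite /= (U_adj _ _ ij).
have [V [VP TtE r3 r4]] :=
  twisted_relations sigma_rep sigma_nd U_sigma U_T X XX TS Ss.
split=> [i|i j ij|i j ij|i j ij].
- split; first exact: T_linear.
    exact: (completely_contractive_comp sigma_rep sigma_nd (Sc i) (TS i)).
  move=> a x b h; rewrite /= TS /= !(sigM sigma_rep) TS /=.
  by rewrite -[S i _]/((S i \o sigma (alpha i a)) _) -Ss.
- split; [exact: U_unitary|exact: U_adj| |by move=> a; apply: U_sigma].
  move=> l x; have [Vt Vs VK VK'] := VP l.
  rewrite /= [tilde _ _ x]TtE (U_S sigma_nd U_sigma U_T TS _ _ ij).
  rewrite [tilde _ _ _]TtE (ampE (VP l)) /= ?VK // => a.
  exact: U_sigma.
- exact/(r3 i j ij)/(S3 i j ij).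
have ji : j != i by rewrite eq_sym.
apply/(r4 i j ij) => x.
by have := S4 j i ji x; rewrite /= -(U_adj _ _ ji).
Qed.
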